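(* The FSR IRREDUCIBILITY problem is NP-hard: the (NP-complete) CIRCUIT SATISFIABILITY problem is polynomial-time Karp reducible to the problem whose instances are feedback shift registers $f$, given by their feedback logic $f_1$ as a Boolean circuit (input size $|f_1|$), and whose question is ''Is $f$ irreducible?''.
   Context: A Boolean circuit with $m$ inputs is a directed acyclic graph with $m$ sources (the inputs) and one sink (the output), each non-source vertex being a gate AND or OR (fan-in 2) or NOT (fan-in 1); its size $|f|$ is its number of vertices. It is satisfiable if some input makes it output 1. CIRCUIT SATISFIABILITY: given a Boolean circuit, decide whether it is satisfiable. An $n$-stage feedback shift register (FSR) with feedback logic $f_1:\{0,1\}^n\to\{0,1\}$ has state $(x_0,\dots,x_{n-1})$ updated by $(x_0,\dots,x_{n-1})\mapsto(x_1,\dots,x_{n-1},f_1(x_0,\dots,x_{n-1}))$; its characteristic function is $f(x_0,\dots,x_n)=x_n\oplus f_1(x_0,\dots,x_{n-1})$ and the FSR is also denoted $f$. The set of sequences generated by $f$ is $S(f)=\{s\in\{0,1\}^{\mathbb N}: f(s(t),s(t+1),\dots,s(t+n))=0 \text{ for all } t\}$. If there is an $m$-stage FSR $g$ with $m<n$ and $S(g)\subseteq S(f)$, then $g$ is a subFSR of $f$ and $f$ is reducible; otherwise $f$ is irreducible. A decision problem $P$ is polynomial-time Karp reducible to $Q$ if there is a polynomial-time computable map $T$ from instances of $P$ to instances of $Q$ such that $x$ is a yes-instance of $P$ iff $T(x)$ is a yes-instance of $Q$. A problem is NP-hard if an NP-complete problem is polynomial-time Karp reducible to it. *)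

(* Defs.v *)
From Stdlib Require Import List Arith Bool.
Import ListNotations.

(* A circuit with m inputs: vertices 0..m-1 are the inputs; the k-th   *)
(* gate of [c_gates] is vertex m+k and may only read vertices < m+k    *)
(* (so the graph is acyclic).  The output (sink) is the last vertex.   *)
Inductive gate : Type :=
| GAnd : nat -> nat -> gate
| GOr  : nat -> nat -> gate
| GNot : nat -> gate.

Record circuit : Type := Circuit { c_inputs : nat; c_gates : list gate }.

Definition gate_args (g : gate) : list nat :=
  match g with GAnd i j => [i; j] | GOr i j => [i; j] | GNot i => [i] end.

Definition csize (C : circuit) : nat := c_inputs C + length (c_gates C).

(* Well-formed circuit: a DAG (each gate reads earlier vertices; the two
   predecessors of a binary gate are distinct vertices), with at least
   one vertex, and a single sink: every vertex other than the output
   vertex (the last one) is read by some gate. *)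
Definition circuit_wf (C : circuit) : Prop :=
  0 < csize C /\
  (forall k g, nth_error (c_gates C) k = Some g ->
     (forall i, In i (gate_args g) -> i < c_inputs C + k) /\
     (match g with GAnd i j | GOr i j => i <> j | GNot _ => True end)) /\
  (forall v, v < csize C - 1 ->
     exists k g, nth_error (c_gates C) k = Some g /\ In v (gate_args g)).

Definition gate_val (vals : list bool) (g : gate) : bool :=
  match g with
  | GAnd i j => nth i vals false && nth j vals false
  | GOr i j => nth i vals false || nth j vals false
  | GNot i => negb (nth i vals false)
  end.

Fixpoint eval_gates (vals : list bool) (gs : list gate) : list bool :=
  match gs with
  | [] => vals
  | g :: r => eval_gates (vals ++ [gate_val vals g]) r
  end.

Definition circuit_out (C : circuit) (x : list bool) : bool :=
  last (eval_gates x (c_gates C)) false.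

Definition circuit_satisfiable (C : circuit) : Prop :=
  exists x : list bool, length x = c_inputs C /\ circuit_out C x = true.

Definition window (s : nat -> bool) (t m : nat) : list bool :=
  map (fun i => s (t + i)) (seq 0 m).

(* S(f) for the m-stage FSR with feedback logic f1 : {0,1}^m -> {0,1}
   (f1 is only ever applied to lists of length m):
   f(s t,...,s(t+m)) = s(t+m) xor f1(s t,...,s(t+m-1)) = 0 for all t. *)
Definition fsr_seq (m : nat) (f1 : list bool -> bool) (s : nat -> bool) : Prop :=
  forall t, xorb (s (t + m)) (f1 (window s t m)) = false.

Definition fsr_reducible (n : nat) (f1 : list bool -> bool) : Prop :=
  exists (m : nat) (g1 : list bool -> bool),
    1 <= m /\ m < n /\ (forall s, fsr_seq m g1 s -> fsr_seq n f1 s).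

Definition fsr_irreducible (n : nat) (f1 : list bool -> bool) : Prop :=
  ~ fsr_reducible n f1.

Definition circuit_fsr_irreducible (D : circuit) : Prop :=
  fsr_irreducible (c_inputs D) (circuit_out D).

Definition enc_nat (n : nat) : list bool := repeat true n ++ [false].

Definition enc_gate (g : gate) : list bool :=
  match g with
  | GAnd i j => [false; false] ++ enc_nat i ++ enc_nat j
  | GOr i j => [false; true] ++ enc_nat i ++ enc_nat j
  | GNot i => [true; false] ++ enc_nat i
  end.

Definition enc_circuit (C : circuit) : list bool :=
  enc_nat (c_inputs C) ++ flat_map enc_gate (c_gates C).

(* Deterministic single-tape Turing machines, tape alphabet            *)
(* {blank (None), 0 (Some false), 1 (Some true)}, two-way infinite     *)
(* tape, finitely many states 0..tm_nstates-1, start state 0.          *)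
(* tm_delta q a = None means "halt".                                   *)
Inductive move : Type := MLeft | MRight | MStay.

Record TM : Type := MkTM {
  tm_nstates : nat;
  tm_delta : nat -> option bool -> option (nat * option bool * move) }.

Definition tm_wf (M : TM) : Prop :=
  0 < tm_nstates M /\
  forall q a q' b d, q < tm_nstates M ->
    tm_delta M q a = Some (q', b, d) -> q' < tm_nstates M.

(* state, tape left of head (nearest first), scanned symbol, tape right *)
Record config : Type := Cfg {
  cf_state : nat; cf_left : list (option bool);
  cf_cur : option bool; cf_right : list (option bool) }.

Definition step (M : TM) (c : config) : option config :=
  match tm_delta M (cf_state c) (cf_cur c) with
  | None => None
  | Some (q', b, d) =>
      Some (match d with
            | MStay => Cfg q' (cf_left c) b (cf_right c)
            | MLeft => match cf_left c with
                       | [] => Cfg q' [] None (b :: cf_right c)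
                       | x :: l => Cfg q' l x (b :: cf_right c)
                       end
            | MRight => match cf_right c with
                        | [] => Cfg q' (b :: cf_left c) None []
                        | x :: r => Cfg q' (b :: cf_left c) x r
                        end
            end)
  end.

Fixpoint run_within (M : TM) (fuel : nat) (c : config) : option config :=
  match step M c with
  | None => Some c
  | Some c' => match fuel with 0 => None | S f => run_within M f c' end
  end.

Definition init_config (w : list bool) : config :=
  match w with
  | [] => Cfg 0 [] None []
  | a :: r => Cfg 0 [] (Some a) (map Some r)
  end.

Fixpoint read_word (l : list (option bool)) : list bool :=
  match l with
  | Some b :: r => b :: read_word r
  | _ => []
  end.

Definition tm_output (c : config) : list bool := read_word (cf_cur c :: cf_right c).

Definition poly_karp_reducible_circ (P Q : circuit -> Prop) : Prop :=
  exists (M : TM) (a d : nat),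
    tm_wf M /\
    forall C, circuit_wf C ->
      exists (D : circuit) (cf : config),
        circuit_wf D /\
        run_within M (a * length (enc_circuit C) ^ d + a)
                   (init_config (enc_circuit C)) = Some cf /\
        tm_output cf = enc_circuit D /\
        (P C <-> Q D).

(* Main.v *)
Require Import Defs.
From Stdlib Require Import List Arith Bool Lia.
Import ListNotations.

(* From a circuit C with N inputs, build the (N+2)-stage feedback that outputs, at a
   state (x_0, ..., x_N, b):
     if b = 1: 1, unless x_0 ... x_N are all equal, in which case 0;
     if b = 0: 1 if x_1 ... x_N are all 0 or C(x_0, ..., x_(N-1)) = 1, and 0 otherwise.
   If a subregister passes through (w, 1) with w <> 0, it runs into 1^(N+2) and then
   1^(N+1) 0, two states with a common prefix of N+1 bits, which is impossible.  Hence
   in a subregister any two ones are at least N+2 steps apart; as N+1 zeros force a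
   one, they are exactly N+2 apart far enough on, so the subregister has N+1 stages
   (it generates 0^N 0 and 0^N 1).  Being able to start from (x, 1) for any x, it
   excludes C(x) = 1, which would put a 1 too close behind.  Conversely, if C is
   unsatisfiable, then the NOR of N+1 bits generates a subregister.

   The reduction is computed by a queue machine, which a Turing machine simulates by
   popping at the left and pushing at the right end of its tape content.  The queue
   holds a word over a finite alphabet.  Each pass over it consumes one unit (a 1 of the
   unary N, or a gate of C) and rewrites the rest by a substitution, under which a
   unary number grows by a fixed amount and a list of gates gets one more gate; n
   passes thus produce numbers and gate lists that depend linearly on n. *)

(** * Feedback shift registers *)

Lemma length_window s t m : length (window s t m) = m.
Proof. unfold window. now rewrite length_map, length_seq. Qed.

Lemma nth_window s t m i : i < m -> nth i (window s t m) false = s (t + i).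
Proof.
  intro Hi. unfold window.
  rewrite (nth_indep _ false (s (t + 0))) by now rewrite length_map, length_seq.
  rewrite (map_nth (fun i => s (t + i))), seq_nth; trivial.
Qed.

Lemma window_ext s t s' t' m :
  (forall i, i < m -> s (t + i) = s' (t' + i)) -> window s t m = window s' t' m.
Proof.
  intro H. apply map_ext_in. intros i Hi. apply H. apply in_seq in Hi. lia.
Qed.

Lemma fsr_seq_eq m g s t : fsr_seq m g s -> s (t + m) = g (window s t m).
Proof. intro H. apply xorb_eq. apply H. Qed.

(** Agreement on at least m bits fixes the state, hence the next bit. This bounds the number of
    stages of a subregister from below. *)
Lemma fsr_seq_determined m g s t t' k :
  fsr_seq m g s -> m <= k -> (forall i, i < k -> s (t + i) = s (t' + i)) ->
  s (t + k) = s (t' + k).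
Proof.
  intros Hs Hm Heq.
  replace (t + k) with (t + (k - m) + m) by lia.
  replace (t' + k) with (t' + (k - m) + m) by lia.
  rewrite !(fsr_seq_eq _ _ _ _ Hs). f_equal. apply window_ext. intros i Hi.
  rewrite <- !Nat.add_assoc. apply Heq. lia.
Qed.

Fixpoint fsr_state (g : list bool -> bool) (w : list bool) (t : nat) : list bool :=
  match t with
  | 0 => w
  | S t => let st := fsr_state g w t in tl st ++ [g st]
  end.

(** The sequence reads off the first bit of each successive state. *)
Lemma fsr_seq_from_state m g w :
  1 <= m -> length w = m -> exists s, fsr_seq m g s /\ window s 0 m = w.
Proof.
  intros Hm Hw.
  assert (Hlen : forall t, length (fsr_state g w t) = m).
  { induction t as [|t IH]; simpl; trivial.
    rewrite length_app. destruct (fsr_state g w t); simpl in *; lia. }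
  set (s t := nth 0 (fsr_state g w t) false).
  (* Bit i of a state is the first bit of the state i steps later. *)
  assert (Hnth : forall i t, i < m -> nth i (fsr_state g w t) false = s (t + i)).
  { induction i as [|i IH]; intros t Hi.
    - now rewrite Nat.add_0_r.
    - replace (t + S i) with (S t + i) by lia. rewrite <- IH by lia. simpl.
      specialize (Hlen t). destruct (fsr_state g w t) as [|x l]; simpl in *; [lia|].
      now rewrite app_nth1 by lia. }
  assert (Hwin : forall t, window s t m = fsr_state g w t).
  { intro t. apply (nth_ext _ _ false false).
    - now rewrite length_window.
    - intros i Hi. rewrite length_window in Hi.
      now rewrite nth_window, Hnth. }
  exists s. split; [|exact (Hwin 0)].
  intro t. rewrite Hwin. replace (t + m) with (S t + (m - 1)) by lia.
  rewrite <- Hnth by lia. simpl.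
  assert (Ht : length (tl (fsr_state g w t)) = m - 1).
  { rewrite length_tl. now rewrite Hlen. }
  rewrite app_nth2, Ht, Nat.sub_diag by lia. apply xorb_nilpotent.
Qed.

(** The newest bit, at index N+1, is b. For b = 1, the value 0 after N+1 zeros admits isolated ones,
    while the value 0 after N+1 ones ends a full run of ones, which no register with fewer than N+2
    stages can reproduce. *)
Definition test_feedback (N : nat) (c : list bool -> bool) (x : list bool) : bool :=
  let bit i := nth i x false in
  if bit (N + 1)
  then existsb bit (seq 0 (N + 1)) && negb (forallb bit (seq 0 (N + 1)))
  else negb (existsb bit (seq 1 N)) || c (firstn N x).

Lemma existsb_window s t n p k :
  p + k <= n ->
  existsb (fun i => nth i (window s t n) false) (seq p k) = true <->
  exists i, p <= i < p + k /\ s (t + i) = true.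
Proof.
  intro H. rewrite existsb_exists. split; intros (i & Hi & Hs); exists i.
  - apply in_seq in Hi. rewrite nth_window in Hs by lia. now split.
  - split; [now apply in_seq|]. now rewrite nth_window by lia.
Qed.

Lemma forallb_window s t n p k :
  p + k <= n ->
  forallb (fun i => nth i (window s t n) false) (seq p k) = true <->
  forall i, p <= i < p + k -> s (t + i) = true.
Proof.
  intro H. rewrite forallb_forall. split; intros Hs i Hi.
  - rewrite <- (nth_window s t n) by lia. apply Hs. now apply in_seq.
  - apply in_seq in Hi. rewrite nth_window by lia. now apply Hs.
Qed.

Lemma firstn_window s t n m : m <= n -> firstn m (window s t n) = window s t m.
Proof.
  intro H. unfold window. rewrite firstn_map. f_equal.
  replace n with (m + (n - m)) by lia. rewrite seq_app, firstn_app, length_seq, Nat.sub_diag.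
  rewrite firstn_all2 by (rewrite length_seq; lia). now rewrite app_nil_r.
Qed.

(** Exhaustive search replaces excluded middle: irreducibility is a negated statement, yet a
    satisfying input must be extracted from it. *)
Lemma word_search N (c : list bool -> bool) :
  (exists x, length x = N /\ c x = true) \/ (forall x, length x = N -> c x = false).
Proof.
  revert c. induction N as [|N IH]; intro c.
  - destruct (c []) eqn:E; [left; now exists []|right].
    intros [|]; [trivial|discriminate].
  - destruct (IH (fun x => c (true :: x))) as [(x & Hx & Hc)|H1];
      [left; exists (true :: x); simpl; auto|].
    destruct (IH (fun x => c (false :: x))) as [(x & Hx & Hc)|H0];
      [left; exists (false :: x); simpl; auto|].
    right. intros [|[] x] Hx; [discriminate| |]; injection Hx; auto.
Qed.

(** * Steps of the test register *)

Section TestRegister.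
Variables (N : nat) (c : list bool -> bool).
Hypothesis HN : 1 <= N.
Local Notation F := (test_feedback N c).

Section Step.
Variable s : nat -> bool.
Hypothesis Hs : fsr_seq (N + 2) F s.

Lemma test_step t :
  s (t + (N + 2)) =
  if s (t + (N + 1))
  then existsb (fun i => nth i (window s t (N + 2)) false) (seq 0 (N + 1)) &&
       negb (forallb (fun i => nth i (window s t (N + 2)) false) (seq 0 (N + 1)))
  else negb (existsb (fun i => nth i (window s t (N + 2)) false) (seq 1 N)) || c (window s t N).
Proof.
  rewrite (fsr_seq_eq _ _ _ _ Hs). unfold test_feedback.
  rewrite nth_window, firstn_window by lia. reflexivity.
Qed.

Lemma test_step_one t i :
  s (t + (N + 1)) = true -> i <= N -> s (t + i) = true ->
  s (t + (N + 2)) = true \/ forall j, j <= N + 1 -> s (t + j) = true.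
Proof.
  intros Hb Hi Hsi. rewrite test_step, Hb.
  destruct (forallb _ _) eqn:E.
  - right. intros j Hj. destruct (Nat.eq_dec j (N + 1)) as [->|]; trivial.
    rewrite forallb_window in E by lia. apply E. lia.
  - left. rewrite andb_true_r. apply existsb_window; [lia|]. exists i. split; [lia|trivial].
Qed.

Lemma test_step_all_ones t :
  (forall j, j <= N + 1 -> s (t + j) = true) -> s (t + (N + 2)) = false.
Proof.
  intro H. rewrite test_step, H by lia.
  replace (forallb _ _) with true; [apply andb_false_r|].
  symmetry. apply forallb_window; [lia|]. intros i Hi. apply H. lia.
Qed.

Lemma test_step_zeros t :
  (forall j, 1 <= j <= N + 1 -> s (t + j) = false) -> s (t + (N + 2)) = true.
Proof.
  intro H. rewrite test_step, H by lia.
  replace (existsb _ _) with false; [reflexivity|].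
  symmetry. apply not_true_iff_false. rewrite existsb_window by lia.
  intros (i & Hi & Ht). rewrite H in Ht by lia. discriminate.
Qed.

Lemma test_step_sat t :
  s (t + (N + 1)) = false -> c (window s t N) = true -> s (t + (N + 2)) = true.
Proof. intros Hb Hc. rewrite test_step, Hb, Hc. apply orb_true_r. Qed.

(** Each new one has another one right before it, so ones keep coming until N+2 of them fill a
    window. *)
Lemma test_reaches_all_ones t :
  s (t + N) = true -> s (t + (N + 1)) = true ->
  exists u, forall j, j <= N + 1 -> s (u + j) = true.
Proof.
  intros H0 H1.
  (* Either this has happened, or a run of k+2 ones starts at t+N. *)
  assert (Hrun : forall k, (exists u, forall j, j <= N + 1 -> s (u + j) = true) \/
                           forall j, j <= S k -> s (t + N + j) = true).
  { induction k as [|k [IH|IH]]; [right|now left|].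
    - intros [|[|j]] Hj; [now rewrite Nat.add_0_r| |lia].
      now rewrite <- Nat.add_assoc.
    - destruct (test_step_one (t + k) N) as [H|H].
      + rewrite <- (IH (S k)) by lia. f_equal. lia.
      + lia.
      + rewrite <- (IH k) by lia. f_equal. lia.
      + right. intros j Hj. destruct (Nat.eq_dec j (S (S k))) as [->|].
        * rewrite <- H. f_equal. lia.
        * apply IH. lia.
      + left. now exists (t + k). }
  destruct (Hrun N) as [H|H]; trivial.
  exists (t + N). intros j Hj. apply H. lia.
Qed.
End Step.

(** * Subregisters of the test register *)

Section SubRegister.
Variables (m : nat) (g : list bool -> bool).
Hypothesis Hm1 : 1 <= m.
Hypothesis Hm2 : m < N + 2.
Hypothesis Hsub : forall s, fsr_seq m g s -> fsr_seq (N + 2) F s.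

(* Otherwise the run reaches 1^(N+2), whose successor is 1^(N+1) 0: both
   start with 1^(N+1), so fewer than N+2 stages cannot generate it. *)
Lemma sub_ones_isolated s t i :
  fsr_seq m g s -> i <= N -> s (t + (N + 1)) = true -> s (t + i) = false.
Proof.
  intros Hg Hi Hb. apply not_true_iff_false. intro Hsi.
  pose proof (Hsub s Hg) as Hs.
  assert (exists u, forall j, j <= N + 1 -> s (u + j) = true) as [u Hu].
  { destruct (test_step_one s Hs t i Hb Hi Hsi) as [H|H].
    - apply (test_reaches_all_ones s Hs (t + 1)).
      + rewrite <- Hb. f_equal. lia.
      + rewrite <- H. f_equal. lia.
    - now exists t. }
  assert (s (u + (N + 1)) = s (u + 1 + (N + 1))) as E.
  { apply (fsr_seq_determined m g); [assumption|lia|].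
    intros j Hj. rewrite <- Nat.add_assoc, !Hu by lia. reflexivity. }
  rewrite Hu in E by lia. rewrite <- Nat.add_assoc in E.
  replace (1 + (N + 1)) with (N + 2) in E by lia.
  rewrite (test_step_all_ones s Hs u Hu) in E. discriminate.
Qed.

Lemma sub_full_stage : m = N + 1.
Proof.
  destruct (fsr_seq_from_state m g (repeat false m) Hm1) as (s & Hg & _);
    [apply repeat_length|].
  pose proof (Hsub s Hg) as Hs.
  (* Otherwise positions N+1 to 2N+1 hold zeros only, and these force a one at 2N+2. *)
  assert (exists t, s (t + (N + 1)) = true) as [t Ht].
  { destruct (existsb (fun j => s (j + (N + 1))) (seq 0 (N + 1))) eqn:E.
    - apply existsb_exists in E. destruct E as (j & _ & Hj). now exists j.
    - exists (N + 1). rewrite <- (test_step_zeros s Hs N).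
      + f_equal. lia.
      + intros j Hj. apply not_true_iff_false. intro Hc.
        apply not_true_iff_false in E. apply E, existsb_exists.
        exists (j - 1). split; [apply in_seq; lia|]. rewrite <- Hc. f_equal. lia. }
  destruct (le_lt_dec m N) as [Hle|]; [exfalso|lia].
  (* A one among the next N+1 bits would have the one at t+N+1 in its window. *)
  assert (Hz : forall i, i <= N -> s (t + (N + 2) + i) = false).
  { intros i Hi. apply not_true_iff_false. intro Hc.
    assert (s (t + i + 1 + (N - i)) = false) as E.
    { apply sub_ones_isolated; trivial; [lia|]. rewrite <- Hc. f_equal. lia. }
    replace (t + i + 1 + (N - i)) with (t + (N + 1)) in E by lia. congruence. }
  (* N zeros precede the one at t+N+1 and also the zero at t+2N+2, so at most N stages cannot tell
     the two situations apart. *)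
  assert (s (t + 1 + N) = s (t + (N + 2) + N)) as E.
  { apply (fsr_seq_determined m g); trivial. intros i Hi.
    rewrite Hz by lia. rewrite <- Nat.add_assoc. apply sub_ones_isolated; trivial. }
  rewrite Hz in E by lia. replace (t + 1 + N) with (t + (N + 1)) in E by lia. congruence.
Qed.

Lemma sub_rejects x : length x = N -> c x = false.
Proof.
  intro Hx. apply not_true_iff_false. intro Hc. pose proof sub_full_stage as Em.
  (* With N+1 stages, all bits of (x, 1) can be prescribed as the initial state. *)
  destruct (fsr_seq_from_state m g (x ++ [true]) Hm1) as (s & Hg & Hw).
  { rewrite length_app, Hx, Em. reflexivity. }
  pose proof (Hsub s Hg) as Hs. rewrite Em in Hw.
  assert (HN1 : s N = true).
  { change N with (0 + N) at 1. rewrite <- (nth_window s 0 (N + 1)) by lia.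
    rewrite Hw, app_nth2, Hx, Nat.sub_diag by lia. reflexivity. }
  assert (s (0 + (N + 1)) = false) as Hb.
  { apply not_true_iff_false. intro Hb.
    apply (sub_ones_isolated s 0 N) in Hb; trivial. simpl in Hb. congruence. }
  assert (s (0 + (N + 2)) = true) as H2.
  { apply test_step_sat; trivial.
    rewrite <- (firstn_window s 0 (N + 1)) by lia.
    rewrite Hw, firstn_app, Hx, Nat.sub_diag, firstn_O, app_nil_r.
    rewrite <- Hx, firstn_all. exact Hc. }
  (* The window from 1 to N+2 ends in a one and, as N >= 1, contains position N. *)
  assert (s (1 + (N - 1)) = false) as E.
  { apply sub_ones_isolated; trivial; [lia|]. rewrite <- H2. f_equal. lia. }
  replace (1 + (N - 1)) with N in E by lia. congruence.
Qed.
End SubRegister.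

(** * The NOR register *)

Definition nor_feedback (w : list bool) : bool := negb (existsb (fun b => b) w).

Lemma nor_window s t m :
  fsr_seq m nor_feedback s ->
  s (t + m) = true <-> forall i, i < m -> s (t + i) = false.
Proof.
  intro H. rewrite (fsr_seq_eq _ _ _ _ H). unfold nor_feedback. split.
  - intros E i Hi. apply not_true_iff_false. intro Hc.
    apply negb_true_iff, not_true_iff_false in E. apply E, existsb_exists.
    exists true. split; trivial. rewrite <- Hc, <- (nth_window s t m) by trivial.
    apply nth_In. now rewrite length_window.
  - intros E. apply negb_true_iff, not_true_iff_false. rewrite existsb_exists.
    intros (b & Hb & ->). apply in_map_iff in Hb. destruct Hb as (i & Hi & Hin).
    apply in_seq in Hin. rewrite E in Hi by lia. discriminate.
Qed.

(** If b = 1, the N+1 bits before b are 0, so they are all equal and the test gives 0, as does NOR.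
    If b = 0 and c is never true, both feedbacks ask whether x_1, ..., x_N are 0. *)
Lemma nor_sub_test s :
  (forall x, length x = N -> c x = false) ->
  fsr_seq (N + 1) nor_feedback s -> fsr_seq (N + 2) F s.
Proof.
  intros Hc Hs t.
  enough (s (t + (N + 2)) = F (window s t (N + 2))) as -> by apply xorb_nilpotent. unfold test_feedback.
  rewrite nth_window, firstn_window, Hc, orb_false_r by (rewrite ?length_window; lia).
  replace (t + (N + 2)) with (t + 1 + (N + 1)) by lia.
  destruct (s (t + (N + 1))) eqn:Hb.
  - replace (existsb _ _) with false.
    + rewrite andb_false_l. apply not_true_iff_false. rewrite (nor_window s (t + 1) (N + 1) Hs). intro H.
      specialize (H N ltac:(lia)). replace (t + 1 + N) with (t + (N + 1)) in H by lia. congruence.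
    + symmetry. apply not_true_iff_false. rewrite existsb_window by lia.
      intros (i & Hi & Hsi). rewrite (nor_window s t (N + 1) Hs) in Hb.
      rewrite Hb in Hsi by lia. discriminate.
  - apply eq_true_iff_eq. rewrite (nor_window s (t + 1) (N + 1) Hs).
    rewrite negb_true_iff, <- not_true_iff_false, existsb_window by lia. split.
    + intros H (i & Hi & Hsi). specialize (H (i - 1) ltac:(lia)).
      replace (t + 1 + (i - 1)) with (t + i) in H by lia. congruence.
    + intros H i Hi. apply not_true_iff_false. intro Hsi.
      destruct (Nat.eq_dec i N) as [->|].
      * replace (t + 1 + N) with (t + (N + 1)) in Hsi by lia. congruence.
      * apply H. exists (i + 1). split; [lia|]. rewrite <- Hsi. f_equal. lia.
Qed.

Lemma test_irreducible :
  fsr_irreducible (N + 2) F <-> exists x, length x = N /\ c x = true.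
Proof.
  split.
  - intro H. destruct (word_search N c) as [Hc|Hc]; [exact Hc|]. exfalso. apply H.
    exists (N + 1), nor_feedback. split; [lia|]. split; [lia|].
    intros s Hs. now apply nor_sub_test.
  - intros (x & Hx & Hc) (m & g & Hm1 & Hm2 & Hsub).
    rewrite (sub_rejects m g Hm1 Hm2 Hsub x Hx) in Hc. discriminate.
Qed.
End TestRegister.

(** * The circuit of the feedback logic *)

Definition shift_gate (k : nat) (g : gate) : gate :=
  match g with
  | GAnd i j => GAnd (i + k) (j + k)
  | GOr i j => GOr (i + k) (j + k)
  | GNot i => GNot (i + k)
  end.

(** Gate j is vertex N+2+j, so its second argument is the vertex just before it; for j = 0 this is
    the input b. *)
Definition and_chain (N : nat) : list gate :=
  map (fun j => GAnd j (N + 1 + j)) (seq 0 (N + 1)).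
(** The chain starts from the conjunction at vertex 2N+2. This is harmless: for b = 0 the
    conjunction is 0, and where it is 1 the negation of that vertex makes the feedback 0. *)
Definition or_chain (N : nat) : list gate :=
  map (fun j => GOr (1 + j) (2 * N + 2 + j)) (seq 0 N).
(** Vertices 3N+3 to 3N+10, the last being the feedback without the contribution of C. *)
Definition base_gates (N : nat) : list gate :=
  [GOr 0 (3 * N + 2); GNot (2 * N + 2); GAnd (3 * N + 3) (3 * N + 4);
   GAnd (N + 1) (3 * N + 5); GNot (N + 1); GNot (3 * N + 2);
   GAnd (3 * N + 7) (3 * N + 8); GOr (3 * N + 6) (3 * N + 9)].
(** The copies stand right before the gates of C, so that one shift renames all of C. Binary gates
    need distinct arguments, and the negation of b is a neutral second one because C only matters
    for b = 0. *)
Definition input_copies (N : nat) : list gate :=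
  map (fun j => GAnd j (3 * N + 7)) (seq 0 N).
(** Vertex 4N+10+G is the output of the shifted C. *)
Definition final_gates (N G : nat) : list gate :=
  [GAnd (3 * N + 7) (4 * N + 10 + G); GOr (3 * N + 10) (4 * N + 11 + G)].

(* Vertex N+1 is the last input b; vertex 2N+2 is the conjunction of all inputs,
   3N+2 the disjunction of x_1..x_N (or'ed with vertex 2N+2), 3N+7 is not b, and
   3N+11..4N+10 are the copies of x_0..x_(N-1) that feed C. *)
Definition test_circuit (C : circuit) : circuit :=
  let N := c_inputs C in
  Circuit (N + 2)
    (and_chain N ++ or_chain N ++ base_gates N ++ input_copies N ++
     map (shift_gate (3 * N + 11)) (c_gates C) ++ final_gates N (length (c_gates C))).

(** * Evaluation of the circuit *)

Lemma eval_gates_app vals g1 g2 :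
  eval_gates vals (g1 ++ g2) = eval_gates (eval_gates vals g1) g2.
Proof. revert vals. induction g1; simpl; auto. Qed.

Lemma length_eval_gates vals gs :
  length (eval_gates vals gs) = length vals + length gs.
Proof.
  revert vals. induction gs as [|g gs IH]; intro vals; simpl; [lia|].
  rewrite IH, length_app. simpl. lia.
Qed.

Lemma eval_gates_old vals gs i :
  i < length vals -> nth i (eval_gates vals gs) false = nth i vals false.
Proof.
  revert vals. induction gs as [|g gs IH]; intros vals Hi; simpl; trivial.
  rewrite IH by (rewrite length_app; lia). now apply app_nth1.
Qed.

Lemma gate_val_shift pre vals g :
  gate_val (pre ++ vals) (shift_gate (length pre) g) = gate_val vals g.
Proof.
  destruct g; simpl; rewrite !app_nth2 by lia; now rewrite !Nat.add_sub.
Qed.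

Lemma eval_gates_shift pre vals gs :
  eval_gates (pre ++ vals) (map (shift_gate (length pre)) gs) = pre ++ eval_gates vals gs.
Proof.
  revert vals. induction gs as [|g gs IH]; intro vals; simpl; trivial.
  now rewrite gate_val_shift, <- app_assoc, IH.
Qed.

(** Vertex q is the last one before the chain and serves as the initial accumulator. *)
Lemma eval_and_chain vals p q k :
  length vals = q + 1 -> p + k <= q + 1 ->
  nth (q + k) (eval_gates vals (map (fun j => GAnd (p + j) (q + j)) (seq 0 k))) false =
  nth q vals false && forallb (fun i => nth i vals false) (seq p k).
Proof.
  intros Hq Hp. induction k as [|k IH].
  - simpl. now rewrite Nat.add_0_r, andb_true_r.
  - rewrite !seq_S, map_app, eval_gates_app, forallb_app. simpl.
    rewrite app_nth2; rewrite length_eval_gates, length_map, length_seq; [|lia].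
    replace (q + S k - (length vals + k)) with 0 by lia. simpl.
    rewrite IH, eval_gates_old by lia.
    now rewrite andb_true_r, andb_comm, andb_assoc.
Qed.

Lemma eval_or_chain vals p q k :
  length vals = q + 1 -> p + k <= q + 1 ->
  nth (q + k) (eval_gates vals (map (fun j => GOr (p + j) (q + j)) (seq 0 k))) false =
  nth q vals false || existsb (fun i => nth i vals false) (seq p k).
Proof.
  intros Hq Hp. induction k as [|k IH].
  - simpl. now rewrite Nat.add_0_r, orb_false_r.
  - rewrite !seq_S, map_app, eval_gates_app, existsb_app. simpl.
    rewrite app_nth2; rewrite length_eval_gates, length_map, length_seq; [|lia].
    replace (q + S k - (length vals + k)) with 0 by lia. simpl.
    rewrite IH, eval_gates_old by lia.
    now rewrite orb_false_r, orb_comm, orb_assoc.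
Qed.

Lemma eval_and_const vals r k p :
  r < length vals -> p + k <= length vals ->
  eval_gates vals (map (fun j => GAnd j r) (seq p k)) =
  vals ++ map (fun j => nth j vals false && nth r vals false) (seq p k).
Proof.
  intros Hr Hk. induction k as [|k IH].
  - simpl. now rewrite app_nil_r.
  - rewrite seq_S, !map_app, eval_gates_app, IH by lia. simpl.
    rewrite !app_nth1 by lia. now rewrite <- app_assoc.
Qed.

Lemma map_nth_seq_firstn (x : list bool) k :
  k <= length x -> map (fun j => nth j x false) (seq 0 k) = firstn k x.
Proof.
  revert x. induction k as [|k IH]; intros x Hk; simpl; trivial.
  destruct x as [|b x]; simpl in *; [lia|].
  rewrite <- seq_shift, map_map. f_equal. apply IH. lia.
Qed.

Lemma last_nth (l : list bool) : last l false = nth (length l - 1) l false.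
Proof.
  induction l as [|b [|b' l] IH]; trivial.
  change (last (b :: b' :: l) false) with (last (b' :: l) false). rewrite IH. simpl.
  now rewrite Nat.sub_0_r.
Qed.

(** Old values and the explicit list of new ones stay apart, so that [nth_new] can find each operand
    by arithmetic on its index. *)
Lemma eval_gates_cons vals new g gs b :
  gate_val (vals ++ new) g = b ->
  eval_gates (vals ++ new) (g :: gs) = eval_gates (vals ++ (new ++ [b])) gs.
Proof. intros <-. simpl. now rewrite app_assoc. Qed.

Lemma existsb_ext_in {A} (f g : A -> bool) l :
  (forall a, In a l -> f a = g a) -> existsb f l = existsb g l.
Proof.
  induction l as [|a l IH]; intro H; simpl; trivial.
  rewrite H by now left. f_equal. apply IH. intros. apply H. now right.
Qed.

Ltac nth_new :=
  cbn [gate_val];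
  repeat first [rewrite app_nth1 by lia | rewrite app_nth2 by lia];
  repeat match goal with |- context [nth (?p - length ?v) (_ :: _)] =>
    first [ replace (p - length v) with 0 by lia | replace (p - length v) with 1 by lia
          | replace (p - length v) with 2 by lia | replace (p - length v) with 3 by lia
          | replace (p - length v) with 4 by lia | replace (p - length v) with 5 by lia
          | replace (p - length v) with 6 by lia ] end;
  cbn [nth].

Lemma eval_base_gates v N b a r x0 :
  length v = 3 * N + 3 ->
  nth 0 v false = x0 -> nth (N + 1) v false = b ->
  nth (2 * N + 2) v false = a -> nth (3 * N + 2) v false = r ->
  exists new, eval_gates v (base_gates N) = v ++ new /\ length new = 8 /\
    nth 4 new false = negb b /\
    nth 7 new false = (b && ((x0 || r) && negb a)) || (negb b && negb r).
Proof.
  intros L H0 Hb Ha Hr. unfold base_gates.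
  (* The list [new] is left open and gets determined by evaluating gate after gate. *)
  eexists. split.
  - rewrite <- (app_nil_r v) at 1.
    rewrite (eval_gates_cons _ _ _ _ (x0 || r)) by (nth_new; congruence).
    rewrite (eval_gates_cons _ _ _ _ (negb a)) by (nth_new; congruence).
    rewrite (eval_gates_cons _ _ _ _ ((x0 || r) && negb a)) by (cbn [app]; nth_new; congruence).
    rewrite (eval_gates_cons _ _ _ _ (b && ((x0 || r) && negb a)))
      by (cbn [app]; nth_new; congruence).
    rewrite (eval_gates_cons _ _ _ _ (negb b)) by (cbn [app]; nth_new; congruence).
    rewrite (eval_gates_cons _ _ _ _ (negb r)) by (cbn [app]; nth_new; congruence).
    rewrite (eval_gates_cons _ _ _ _ (negb b && negb r)) by (cbn [app]; nth_new; congruence).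
    rewrite (eval_gates_cons _ _ _ _ ((b && ((x0 || r) && negb a)) || (negb b && negb r)))
      by (cbn [app]; nth_new; congruence).
    reflexivity.
  - now repeat split.
Qed.

Lemma circuit_out_test C x :
  1 <= c_inputs C -> length x = c_inputs C + 2 ->
  circuit_out (test_circuit C) x = test_feedback (c_inputs C) (circuit_out C) x.
Proof.
  destruct C as [N gs]. cbn [c_inputs]. intros HN Hx.
  unfold circuit_out, test_circuit. cbn [c_inputs c_gates].
  unfold test_feedback.
  set (b := nth (N + 1) x false).
  set (A := forallb (fun i => nth i x false) (seq 0 (N + 1))).
  set (E := existsb (fun i => nth i x false) (seq 1 N)).
  assert (HE : existsb (fun i => nth i x false) (seq 0 (N + 1)) = nth 0 x false || E)
    by now rewrite Nat.add_1_r.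
  assert (HA : A = true -> E = true).
  { intro H. apply existsb_exists. exists 1. split; [apply in_seq; lia|].
    unfold A in H. rewrite forallb_forall in H. apply H, in_seq. lia. }
  rewrite !eval_gates_app.
  set (v1 := eval_gates x (and_chain N)).
  assert (L1 : length v1 = 2 * N + 3).
  { unfold v1, and_chain. rewrite length_eval_gates, length_map, length_seq. lia. }
  assert (O1 : forall i, i < N + 2 -> nth i v1 false = nth i x false).
  { intros i Hi. apply eval_gates_old. lia. }
  assert (A1 : nth (2 * N + 2) v1 false = b && A).
  { replace (2 * N + 2) with (N + 1 + (N + 1)) by lia.
    apply (eval_and_chain x 0 (N + 1) (N + 1)); lia. }
  clearbody v1.
  set (v2 := eval_gates v1 (or_chain N)).
  assert (L2 : length v2 = 3 * N + 3).
  { unfold v2, or_chain. rewrite length_eval_gates, length_map, length_seq. lia. }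
  assert (O2 : forall i, i < 2 * N + 3 -> nth i v2 false = nth i v1 false).
  { intros i Hi. apply eval_gates_old. lia. }
  assert (A2 : nth (3 * N + 2) v2 false = (b && A) || E).
  { replace (3 * N + 2) with (2 * N + 2 + N) by lia. unfold v2, or_chain.
    rewrite (eval_or_chain v1 1 (2 * N + 2) N) by lia. rewrite A1. f_equal.
    apply existsb_ext_in. intros i Hi. apply in_seq in Hi. apply O1. lia. }
  clearbody v2.
  set (R := (b && A) || E) in *.
  destruct (eval_base_gates v2 N b (b && A) R (nth 0 x false)) as (new & -> & L3 & N4 & N7);
    [assumption|rewrite O2, O1 by lia; reflexivity|rewrite O2, O1 by lia; reflexivity
    |rewrite O2 by lia; exact A1|exact A2|].
  set (v3 := v2 ++ new).
  assert (L4 : length v3 = 3 * N + 11) by (unfold v3; rewrite length_app; lia).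
  assert (Hnb : nth (3 * N + 7) v3 false = negb b).
  { unfold v3. rewrite app_nth2, L2 by lia.
    now replace (3 * N + 7 - (3 * N + 3)) with 4 by lia. }
  assert (Hy : nth (3 * N + 10) v3 false =
               (b && ((nth 0 x false || R) && negb (b && A))) || (negb b && negb R)).
  { unfold v3. rewrite app_nth2, L2 by lia.
    now replace (3 * N + 10 - (3 * N + 3)) with 7 by lia. }
  assert (Ox : forall i, i < N + 2 -> nth i v3 false = nth i x false).
  { intros i Hi. unfold v3. rewrite app_nth1, O2 by lia. now apply O1. }
  clearbody v3. clear N4 N7 L3 new O2 A2 L2 v2 O1 A1 L1 v1.
  unfold input_copies. rewrite eval_and_const by lia.
  set (y := map _ (seq 0 N)).
  assert (Ly : length y = N) by (unfold y; now rewrite length_map, length_seq).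
  rewrite <- L4, eval_gates_shift.
  set (z := eval_gates y gs).
  assert (Lz : length z = N + length gs) by (unfold z; rewrite length_eval_gates; lia).
  unfold final_gates. cbn [eval_gates gate_val]. rewrite last_last.
  rewrite (app_nth1 _ _ false (n := 3 * N + 10)) by (rewrite length_app; lia).
  rewrite (app_nth2 _ _ false (n := 4 * N + 11 + length gs)) by (rewrite length_app; lia).
  replace (4 * N + 11 + length gs - length (v3 ++ z)) with 0 by (rewrite length_app; lia).
  cbn [nth].
  rewrite (app_nth1 _ _ false (n := 3 * N + 7)), (app_nth1 _ _ false (n := 3 * N + 10)) by lia.
  rewrite app_nth2 by lia.
  replace (4 * N + 10 + length gs - length v3) with (length z - 1) by lia.
  rewrite <- last_nth, Hy, Hnb, HE. unfold R.
  (* For b = 1 the branch of C vanishes, and either A makes both sides 0 or R is E; for b = 0 the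
     copies are the inputs themselves. *)
  destruct b eqn:Eb; cbn [andb orb negb].
  - rewrite !orb_false_r. destruct A; cbn [orb]; [now rewrite !andb_false_r|reflexivity].
  - unfold z, y. replace (map _ (seq 0 N)) with (firstn N x); [reflexivity|].
    rewrite <- map_nth_seq_firstn by lia. apply map_ext_in. intros i Hi. apply in_seq in Hi.
    now rewrite Hnb, andb_true_r, Ox by lia.
Qed.

(** * Well-formedness of the circuit *)

Definition gate_ok (n : nat) (g : gate) : Prop :=
  (forall i, In i (gate_args g) -> i < n) /\
  match g with GAnd i j | GOr i j => i <> j | GNot _ => True end.

(** Here [n] is the vertex number of the first gate, which lets the condition split along [++]. *)
Definition gates_ok (n : nat) (gs : list gate) : Prop :=
  forall k g, nth_error gs k = Some g -> gate_ok (n + k) g.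

Lemma gates_ok_nil n : gates_ok n [].
Proof. intros [|k] g H; discriminate. Qed.

Lemma gates_ok_cons n g gs : gate_ok n g -> gates_ok (S n) gs -> gates_ok n (g :: gs).
Proof.
  intros Hg H [|k] g' E; simpl in E.
  - injection E as <-. now rewrite Nat.add_0_r.
  - rewrite Nat.add_succ_r. now apply (H k).
Qed.

Lemma gates_ok_app n m gs gs' :
  gates_ok n gs -> m = n + length gs -> gates_ok m gs' -> gates_ok n (gs ++ gs').
Proof.
  intros H -> H' k g E. destruct (le_lt_dec (length gs) k) as [Hk|Hk].
  - rewrite nth_error_app2 in E by exact Hk. apply H' in E.
    now replace (n + length gs + (k - length gs)) with (n + k) in E by lia.
  - rewrite nth_error_app1 in E by exact Hk. now apply H.
Qed.

Lemma gates_ok_map_seq n f k :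
  (forall j, j < k -> gate_ok (n + j) (f j)) -> gates_ok n (map f (seq 0 k)).
Proof.
  intros H j g E. rewrite nth_error_map in E.
  destruct (nth_error (seq 0 k) j) as [i|] eqn:Ei; [|discriminate].
  injection E as <-.
  assert (Hj : j < k).
  { rewrite <- (length_seq k 0). apply nth_error_Some. congruence. }
  apply (nth_error_nth _ _ 0) in Ei. rewrite seq_nth in Ei by exact Hj. subst i.
  now apply H.
Qed.

Lemma gates_ok_shift n s gs :
  gates_ok n gs -> gates_ok (n + s) (map (shift_gate s) gs).
Proof.
  intros H k g E. rewrite nth_error_map in E.
  destruct (nth_error gs k) as [g'|] eqn:Eg; [|discriminate].
  injection E as <-. destruct (H _ _ Eg) as [Ha Hd].
  assert (Hi : forall i, In i (gate_args g') -> i + s < n + s + k)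
    by (intros i Hi; apply Ha in Hi; lia).
  destruct g' as [i j|i j|i]; simpl in *; split; trivial; try lia;
    intros v Hv; repeat destruct Hv as [<-|Hv]; try (apply Hi; auto); contradiction.
Qed.

Lemma gate_args_shift s g : gate_args (shift_gate s g) = map (fun i => i + s) (gate_args g).
Proof. now destruct g. Qed.

Lemma gate_args_in_map {A} (f : A -> gate) l a v :
  In a l -> In v (gate_args (f a)) -> exists g, In g (map f l) /\ In v (gate_args g).
Proof. intros Ha Hv. exists (f a). split; [now apply in_map|exact Hv]. Qed.

(** Otherwise there is a first gate, and it has no earlier vertex to read. *)
Lemma circuit_wf_inputs C : circuit_wf C -> 1 <= c_inputs C.
Proof.
  intros (Hs & Hg & _). destruct C as [[|N] [|g gs]]; unfold csize in *; simpl in *; try lia.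
  destruct (Hg 0 g eq_refl) as [Ha _].
  assert (exists i, In i (gate_args g)) as [i Hi]
    by (destruct g as [i j|i j|i]; exists i; now left).
  apply Ha in Hi. lia.
Qed.

Lemma test_circuit_wf C : circuit_wf C -> circuit_wf (test_circuit C).
Proof.
  intro HC. pose proof (circuit_wf_inputs C HC) as HN.
  destruct HC as (_ & Hok & Hread). destruct C as [N gs].
  unfold test_circuit, circuit_wf, csize in *. cbn [c_inputs c_gates] in *.
  change (gates_ok N gs) in Hok.
  set (G := length gs) in *.
  split; [lia|]. split.
  - change (gates_ok (N + 2) (and_chain N ++ or_chain N ++ base_gates N ++ input_copies N ++
      map (shift_gate (3 * N + 11)) gs ++ final_gates N G)).
    assert (Hb : forall n i j, i < n -> j < n -> i <> j -> gate_ok n (GAnd i j) /\ gate_ok n (GOr i j)).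
    { intros n i j Hi Hj Hd. split; (split; [|exact Hd]);
        intros v [<-|[<-|[]]]; assumption. }
    assert (Hn : forall n i, i < n -> gate_ok n (GNot i)).
    { intros n i Hi. split; [|exact I]. intros v [<-|[]]; assumption. }
    apply gates_ok_app with (2 * N + 3).
    { apply gates_ok_map_seq. intros j Hj. apply Hb; lia. }
    { unfold and_chain. rewrite length_map, length_seq. lia. }
    apply gates_ok_app with (3 * N + 3).
    { apply gates_ok_map_seq. intros j Hj. apply Hb; lia. }
    { unfold or_chain. rewrite length_map, length_seq. lia. }
    apply gates_ok_app with (3 * N + 11).
    { repeat (apply gates_ok_cons; [first [apply Hb|apply Hn]; lia|]). apply gates_ok_nil. }
    { simpl length. lia. }
    apply gates_ok_app with (4 * N + 11).
    { apply gates_ok_map_seq. intros j Hj. apply Hb; lia. }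
    { unfold input_copies. rewrite length_map, length_seq. lia. }
    apply gates_ok_app with (4 * N + 11 + G).
    { replace (4 * N + 11) with (N + (3 * N + 11)) by lia. now apply gates_ok_shift. }
    { now rewrite length_map. }
    repeat (apply gates_ok_cons; [apply Hb; lia|]). apply gates_ok_nil.
  - intros v Hv.
    enough (exists g, In g (and_chain N ++ or_chain N ++ base_gates N ++ input_copies N ++
      map (shift_gate (3 * N + 11)) gs ++ final_gates N G) /\ In v (gate_args g)) as (g & Hg & Hvg).
    { destruct (In_nth_error _ _ Hg) as [k Hk]. now exists k, g. }
    unfold and_chain, or_chain, input_copies in *.
    rewrite !length_app, !length_map, !length_seq in Hv. cbn [length base_gates final_gates] in Hv.
    fold G in Hv.
    (* Readers of v by range: the chains up to 3N+1, the base gates up to 3N+9, then the final gates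
       and the shifted C. *)
    destruct (le_lt_dec v N).
    { destruct (gate_args_in_map (fun j => GAnd j (N + 1 + j)) (seq 0 (N + 1)) v v) as (g & Hg & Hi).
      - apply in_seq. lia.
      - now left.
      - exists g. split; [rewrite !in_app_iff; tauto|exact Hi]. }
    destruct (le_lt_dec v (2 * N + 1)).
    { destruct (gate_args_in_map (fun j => GAnd j (N + 1 + j)) (seq 0 (N + 1)) (v - (N + 1)) v)
        as (g & Hg & Hi).
      - apply in_seq. lia.
      - right. left. lia.
      - exists g. split; [rewrite !in_app_iff; tauto|exact Hi]. }
    destruct (le_lt_dec v (3 * N + 1)).
    { destruct (gate_args_in_map (fun j => GOr (1 + j) (2 * N + 2 + j)) (seq 0 N) (v - (2 * N + 2)) v)
        as (g & Hg & Hi).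
      - apply in_seq. lia.
      - right. left. lia.
      - exists g. split; [rewrite !in_app_iff; tauto|exact Hi]. }
    destruct (le_lt_dec v (3 * N + 9)).
    { assert (exists g, In g (base_gates N) /\ In v (gate_args g)) as (g & Hg & Hi).
      { assert (v = 3 * N + 2 \/ v = 3 * N + 3 \/ v = 3 * N + 4 \/ v = 3 * N + 5 \/
          v = 3 * N + 6 \/ v = 3 * N + 7 \/ v = 3 * N + 8 \/ v = 3 * N + 9) as Hc by lia.
        destruct Hc as [-> | [-> | [-> | [-> | [-> | [-> | [-> | ->]]]]]]];
          [exists (GOr 0 (3 * N + 2))|exists (GAnd (3 * N + 3) (3 * N + 4))
          |exists (GAnd (3 * N + 3) (3 * N + 4))|exists (GAnd (N + 1) (3 * N + 5))
          |exists (GOr (3 * N + 6) (3 * N + 9))|exists (GAnd (3 * N + 7) (3 * N + 8))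
          |exists (GAnd (3 * N + 7) (3 * N + 8))|exists (GOr (3 * N + 6) (3 * N + 9))];
          (split; [unfold base_gates; cbn [In]; tauto|cbn [gate_args In]; tauto]). }
      exists g. split; [rewrite !in_app_iff; tauto|exact Hi]. }
    destruct (le_lt_dec v (3 * N + 10)).
    { exists (GOr (3 * N + 10) (4 * N + 11 + G)). split; [|left; lia].
      rewrite !in_app_iff. cbn [final_gates In]. tauto. }
    destruct (le_lt_dec v (4 * N + 9 + G)).
    (* Copies and gates of C are read as their originals are in C; only the output of C needs a new
       reader. *)
    { destruct (Hread (v - (3 * N + 11))) as (k & g & Hk & Hg); [fold G; lia|].
      exists (shift_gate (3 * N + 11) g). split.
      - rewrite !in_app_iff. do 4 right. left. apply in_map. now apply nth_error_In in Hk.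
      - rewrite gate_args_shift. apply in_map_iff. exists (v - (3 * N + 11)). split; [lia|exact Hg]. }
    destruct (le_lt_dec v (4 * N + 10 + G)).
    { exists (GAnd (3 * N + 7) (4 * N + 10 + G)). split; [|right; left; lia].
      rewrite !in_app_iff. cbn [final_gates In]. tauto. }
    exists (GOr (3 * N + 10) (4 * N + 11 + G)). split; [|right; left; lia].
    rewrite !in_app_iff. cbn [final_gates In]. tauto.
Qed.

Lemma test_circuit_correct C :
  circuit_wf C -> circuit_satisfiable C <-> circuit_fsr_irreducible (test_circuit C).
Proof.
  intro HC. pose proof (circuit_wf_inputs C HC) as HN.
  unfold circuit_satisfiable, circuit_fsr_irreducible.
  rewrite <- (test_irreducible _ (circuit_out C) HN).
  (* The two feedbacks agree on words of length N+2, and all windows have that length. *)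
  assert (E : forall s, fsr_seq (c_inputs C + 2) (circuit_out (test_circuit C)) s <->
                        fsr_seq (c_inputs C + 2) (test_feedback (c_inputs C) (circuit_out C)) s).
  { intro s. unfold fsr_seq. split; intros H t; specialize (H t);
      rewrite circuit_out_test in * by (trivial; apply length_window); exact H. }
  change (c_inputs (test_circuit C)) with (c_inputs C + 2).
  unfold fsr_irreducible, fsr_reducible.
  split; intros H (m & g & H1 & H2 & Hs); apply H; exists m, g;
    (split; [exact H1|]); (split; [exact H2|]); intros s Hg; apply E, Hs, Hg.
Qed.

(** * Queue machines and their simulation by Turing machines *)

Fixpoint tm_iter (M : TM) (k : nat) (c : config) : option config :=
  match k with
  | 0 => Some c
  | S k => match step M c with Some c' => tm_iter M k c' | None => None end
  end.

Lemma tm_iter_trans M k1 k2 c1 c2 c3 :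
  tm_iter M k1 c1 = Some c2 -> tm_iter M k2 c2 = Some c3 ->
  tm_iter M (k1 + k2) c1 = Some c3.
Proof.
  revert c1. induction k1 as [|k1 IH]; intros c1; simpl.
  - now intros [= ->].
  - destruct (step M c1); [apply IH|discriminate].
Qed.

Lemma run_within_iter M k c c' fuel :
  tm_iter M k c = Some c' -> step M c' = None -> k <= fuel -> run_within M fuel c = Some c'.
Proof.
  revert c fuel. induction k as [|k IH]; simpl; intros c fuel H Hh Hk.
  - injection H as ->. destruct fuel; simpl; now rewrite Hh.
  - destruct fuel as [|fuel]; [lia|]. simpl. destruct (step M c); [|discriminate].
    apply IH; trivial. lia.
Qed.

Definition tape (s : nat) (L : list (option bool)) (w : list bool) : config :=
  match w with
  | [] => Cfg s L None []
  | a :: r => Cfg s L (Some a) (map Some r)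
  end.

(** The head is on the cell just left of [R], as during the walk back to the front. *)
Definition tape_left (s : nat) (L R : list (option bool)) : config :=
  match L with
  | [] => Cfg s [] None R
  | x :: l => Cfg s l x R
  end.

Lemma tm_output_tape s L w : tm_output (tape s L w) = w.
Proof.
  assert (H : forall w, read_word (map Some w) = w) by (induction w0; simpl; congruence).
  destruct w as [|a r]; simpl; [reflexivity|]. unfold tm_output. simpl. now rewrite H.
Qed.

Inductive qaction (Q : Type) : Type :=
| QPush : bool -> Q -> qaction Q
| QPop : (bool -> Q) -> qaction Q
| QHalt : qaction Q.
Arguments QPush {Q}. Arguments QPop {Q}. Arguments QHalt {Q}.

Definition qstep {Q} (act : Q -> qaction Q) (c : Q * list bool) : option (Q * list bool) :=
  let (q, w) := c in
  match act q, w with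
  | QPush b q', _ => Some (q', w ++ [b])
  | QPop k, b :: r => Some (k b, r)
  | _, _ => None
  end.

(** [B] bounds the queue length before every step; it turns the number of queue steps into a number
    of Turing machine steps. *)
Inductive qrun {Q} (act : Q -> qaction Q) (B : nat) :
  nat -> Q * list bool -> Q * list bool -> Prop :=
| qrun_refl c : qrun act B 0 c c
| qrun_step k c c' c'' : length (snd c) <= B -> qstep act c = Some c' ->
    qrun act B k c' c'' -> qrun act B (S k) c c''.

Lemma qrun_trans {Q} (act : Q -> qaction Q) B k1 k2 c1 c2 c3 :
  qrun act B k1 c1 c2 -> qrun act B k2 c2 c3 -> qrun act B (k1 + k2) c1 c3.
Proof.
  induction 1 as [|k c c' c'' Hl Hs _ IH]; intro H2; simpl; trivial.
  econstructor; eauto.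
Qed.

Section QueueToTM.
Variables (Q : Type) (Q_dec : forall q q' : Q, {q = q'} + {q <> q'}).
Variables (act : Q -> qaction Q) (q0 : Q) (qs : list Q).

(** The type [Q] may be infinite; a finite list closed under [act] provides the states of the Turing
    machine. *)
Definition q_closed : Prop :=
  forall q, In q (q0 :: qs) ->
    match act q with
    | QPush _ q' => In q' (q0 :: qs)
    | QPop k => forall b, In (k b) (q0 :: qs)
    | QHalt => True
    end.
Hypothesis closed : q_closed.

Fixpoint q_index (l : list Q) (q : Q) : nat :=
  match l with
  | [] => 0
  | x :: l => if Q_dec x q then 0 else S (q_index l q)
  end.

Lemma q_index_spec l q : In q l -> q_index l q < length l /\ nth (q_index l q) l q0 = q.
Proof.
  induction l as [|x l IH]; intro H; [destruct H|]. simpl.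
  destruct (Q_dec x q) as [->|Hne]; simpl; [split; [lia|reflexivity]|].
  destruct H as [H|H]; [contradiction|]. destruct (IH H). split; [lia|assumption].
Qed.

Let n := length (q0 :: qs).
Let idx q := q_index (q0 :: qs) q.

(* State [i < n] simulates the i-th queue state, with the head on the front of
   the queue (or moving right to its end, before a push); state [n + i] moves the
   head back to the front and then enters state [i].  Popped cells are blanked. *)
Definition q_delta (s : nat) (a : option bool) : option (nat * option bool * move) :=
  if s <? n then
    match act (nth s (q0 :: qs) q0), a with
    | QPush b q', Some c => Some (s, Some c, MRight)
    | QPush b q', None => Some (n + idx q', Some b, MLeft)
    | QPop k, Some c => Some (idx (k c), None, MRight)
    | _, _ => None
    end
  else
    match a with
    | Some c => Some (s, Some c, MLeft)
    | None => Some (s - n, None, MRight)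
    end.

Definition q_tm : TM := MkTM (2 * n) q_delta.

Lemma q_tm_wf : tm_wf q_tm.
Proof.
  change (0 < 2 * n /\ forall s a s' b d, s < 2 * n ->
    q_delta s a = Some (s', b, d) -> s' < 2 * n).
  split; [unfold n; simpl; lia|]. intros s a s' b d Hs. unfold q_delta. destruct (Nat.ltb_spec s n) as [Hlt|Hge].
  - assert (Hin : In (nth s (q0 :: qs) q0) (q0 :: qs)) by (apply nth_In; exact Hlt).
    apply closed in Hin. destruct (act _) as [c q'|k|]; [|destruct a|discriminate].
    + destruct (q_index_spec _ _ Hin) as [H _]. fold n in H. destruct a; intros [= <- _ _]; unfold idx, n in *; cbn [length] in *; lia.
    + intros [= <- _ _]. destruct (q_index_spec _ _ (Hin b0)) as [H _]. fold n in H.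
      unfold idx, n in *; cbn [length] in *; lia.
    + discriminate.
  - destruct a; intros [= <- _ _]; unfold n in *; cbn [length] in *; lia.
Qed.

Lemma q_delta_main q a : In q (q0 :: qs) ->
  q_delta (idx q) a =
    match act q, a with
    | QPush b q', Some c => Some (idx q, Some c, MRight)
    | QPush b q', None => Some (n + idx q', Some b, MLeft)
    | QPop k, Some c => Some (idx (k c), None, MRight)
    | _, _ => None
    end.
Proof.
  intro H. destruct (q_index_spec _ _ H) as [Hlt Hn]. unfold q_delta.
  fold n in Hlt. fold (idx q) in Hlt, Hn. apply Nat.ltb_lt in Hlt. now rewrite Hlt, Hn.
Qed.

Lemma q_delta_back i a :
  q_delta (n + i) a =
    match a with
    | Some c => Some (n + i, Some c, MLeft)
    | None => Some (i, None, MRight)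
    end.
Proof.
  unfold q_delta. destruct (Nat.ltb_spec (n + i) n); [lia|].
  now replace (n + i - n) with i by lia.
Qed.

Lemma q_walk_right q b q' L w : In q (q0 :: qs) -> act q = QPush b q' ->
  tm_iter q_tm (length w) (tape (idx q) L w) = Some (tape (idx q) (map Some (rev w) ++ L) []).
Proof.
  intros Hq Ha. revert L. induction w as [|a w IH]; intro L; [reflexivity|].
  cbn [length tm_iter]. unfold step at 1. cbn [tape cf_state cf_cur tm_delta q_tm].
  rewrite (q_delta_main _ _ Hq), Ha. cbn [cf_right cf_left].
  transitivity (tm_iter q_tm (length w) (tape (idx q) (Some a :: L) w)).
  - now destruct w.
  - rewrite IH. simpl rev. rewrite map_app, <- app_assoc. reflexivity.
Qed.

Lemma q_walk_left i L u v :
  tm_iter q_tm (length u) (tape_left (n + i) (map Some u ++ L) (map Some v)) =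
  Some (tape_left (n + i) L (map Some (rev u ++ v))).
Proof.
  revert v. induction u as [|a u IH]; intro v; [reflexivity|].
  cbn [length tm_iter]. unfold step at 1. cbn [tape_left map app cf_state cf_cur tm_delta q_tm].
  rewrite q_delta_back. cbn [cf_right cf_left].
  transitivity (tm_iter q_tm (length u) (tape_left (n + i) (map Some u ++ L) (map Some (a :: v)))).
  - unfold tape_left. now destruct (map Some u ++ L).
  - rewrite IH. simpl rev. now rewrite <- app_assoc.
Qed.

(** The blank before the front is what stops the walk back. *)
Definition blank_left (L : list (option bool)) : Prop := L = [] \/ exists l, L = None :: l.

Lemma q_tm_step q w q' w' L :
  In q (q0 :: qs) -> blank_left L -> qstep act (q, w) = Some (q', w') ->
  In q' (q0 :: qs) /\
  exists L' k, blank_left L' /\ k <= 2 * length w + 2 /\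
    tm_iter q_tm k (tape (idx q) L w) = Some (tape (idx q') L' w').
Proof.
  intros Hq HL Hs. pose proof (closed q Hq) as Hc. simpl in Hs.
  destruct (act q) as [b p|f|] eqn:Ha; [|destruct w as [|b r]; [discriminate|]|discriminate];
    injection Hs as <- <-.
  - split; [exact Hc|].
    assert (exists L', blank_left L' /\
      tm_iter q_tm 1 (tape_left (n + idx p) L (map Some (w ++ [b]))) =
      Some (tape (idx p) L' (w ++ [b]))) as (L' & HL' & HI).
    { destruct HL as [->|[l ->]]; [exists [None]|exists (None :: l)];
        (split; [right; eexists; reflexivity|]);
        cbn [tm_iter tape_left]; unfold step; cbn [cf_state cf_cur tm_delta q_tm];
        rewrite q_delta_back; cbn [cf_right cf_left];
        destruct (w ++ [b]); reflexivity. }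
    (* Right over w, write, left over w onto the blank, and one step back to the front. *)
    exists L', (length w + (1 + (length w + 1))). split; [exact HL'|]. split; [lia|].
    eapply tm_iter_trans; [now apply (q_walk_right q b p)|].
    eapply tm_iter_trans.
    + cbn [tm_iter]. unfold step. cbn [tape cf_state cf_cur tm_delta q_tm].
      rewrite (q_delta_main _ _ Hq), Ha. cbn [cf_right cf_left].
      instantiate (1 := tape_left (n + idx p) (map Some (rev w) ++ L) (map Some [b])).
      unfold tape_left. now destruct (map Some (rev w) ++ L).
    + eapply tm_iter_trans; [rewrite <- (length_rev w); apply q_walk_left|].
      rewrite rev_involutive. exact HI.
  (* The blanked cell is the new blank before the front. *)
  - split; [apply Hc|]. exists (None :: L), 1. split; [right; eexists; reflexivity|].
    split; [lia|]. cbn [tm_iter]. unfold step. cbn [tape cf_state cf_cur tm_delta q_tm].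
    rewrite (q_delta_main _ _ Hq), Ha. cbn [cf_right cf_left]. now destruct r.
Qed.

Lemma q_tm_run B k c c' : qrun act B k c c' ->
  forall L, In (fst c) (q0 :: qs) -> blank_left L ->
  In (fst c') (q0 :: qs) /\
  exists L' k', k' <= k * (2 * B + 2) /\
    tm_iter q_tm k' (tape (idx (fst c)) L (snd c)) = Some (tape (idx (fst c')) L' (snd c')).
Proof.
  induction 1 as [c|k [q w] [q' w'] c'' Hl Hs _ IH]; intros L Hq HL.
  - split; [exact Hq|]. exists L, 0. split; [lia|reflexivity].
  - cbn [fst snd] in *.
    destruct (q_tm_step q w q' w' L Hq HL Hs) as (Hq' & L1 & k1 & HL1 & Hk1 & H1).
    destruct (IH L1 Hq' HL1) as (Hq'' & L2 & k2 & Hk2 & H2).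
    split; [exact Hq''|]. exists L2, (k1 + k2). split; [nia|].
    now apply (tm_iter_trans _ _ _ _ _ _ H1).
Qed.

Lemma q_tm_correct B k w q w' fuel :
  qrun act B k (q0, w) (q, w') -> act q = QHalt -> k * (2 * B + 2) <= fuel ->
  exists cf, run_within q_tm fuel (init_config w) = Some cf /\ tm_output cf = w'.
Proof.
  intros Hr Hh Hf.
  destruct (q_tm_run _ _ _ _ Hr []) as (Hq & L & k' & Hk & HI); cbn [fst snd] in *.
  - now left.
  - now left.
  - exists (tape (idx q) L w'). split; [|apply tm_output_tape].
    apply (run_within_iter _ k'); [|unfold step; destruct w'|lia].
    + rewrite <- HI. f_equal. unfold idx, q_index. destruct (Q_dec q0 q0); [|contradiction].
      now destruct w.
    + cbn [tape cf_state cf_cur tm_delta q_tm]. now rewrite (q_delta_main _ _ Hq), Hh.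
    + cbn [tape cf_state cf_cur tm_delta q_tm]. now rewrite (q_delta_main _ _ Hq), Hh.
Qed.
End QueueToTM.

(** * Queue machines that read and write tokens *)

Fixpoint words_upto (K : nat) : list (list bool) :=
  match K with
  | 0 => [[]]
  | S K => [] :: map (cons true) (words_upto K) ++ map (cons false) (words_upto K)
  end.

Lemma in_words_upto K l : length l <= K -> In l (words_upto K).
Proof.
  revert l. induction K as [|K IH]; intros [|b l] H; simpl in *; auto; [lia|].
  right. apply in_app_iff. destruct b; [left|right]; apply in_map, IH; lia.
Qed.

Lemma words_upto_length K l : In l (words_upto K) -> length l <= K.
Proof.
  revert l. induction K as [|K IH]; intros l; simpl.
  - intros [<-|[]]; simpl; lia.
  - rewrite in_app_iff, !in_map_iff.
    intros [<-|[(l' & <- & H)|(l' & <- & H)]]; simpl; try apply IH in H; lia.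
Qed.

Fixpoint suffixes {A} (l : list A) : list (list A) :=
  l :: match l with [] => [] | _ :: l' => suffixes l' end.

Lemma suffixes_self {A} (l : list A) : In l (suffixes l).
Proof. destruct l; now left. Qed.

Lemma suffixes_tail {A} (l : list A) x l' : In (x :: l') (suffixes l) -> In l' (suffixes l).
Proof.
  induction l as [|y l IH]; simpl.
  - intros [H|[]]; discriminate.
  - intros [[= _ <-]|H]; right; [apply suffixes_self|now apply IH].
Qed.

Section Transducer.
Variables (P : Type) (P_dec : forall p p' : P, {p = p'} + {p <> p'}) (phases : list P).
Hypothesis phases_all : forall p, In p phases.
Variables (trans : P -> list bool -> option (list bool * P)) (halted : P -> bool) (K : nat).
Hypothesis trans_total : forall p l, length l = S K -> trans p l <> None.
Variables (p0 : P) (o0 : list bool).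

(* A state consists of the phase, the bits still to be pushed and the bits read
   of the current token. *)
Definition tstate : Type := (P * list bool * list bool)%type.

Definition t_act (q : tstate) : qaction tstate :=
  match q with
  | (p, b :: o, acc) => QPush b (p, o, acc)
  | (p, [], acc) =>
      if halted p then QHalt
      else QPop (fun b => match trans p (acc ++ [b]) with
                          | None => (p, [], acc ++ [b])
                          | Some (o, p') => (p', o, [])
                          end)
  end.

Definition t_pushes (p : P) (o : list bool) : list tstate :=
  map (fun o' => (p, o', [])) (suffixes o).

(** This covers the reachable states: bits remain to be pushed only while none have been read, and
    at most [K] bits are held without an answer from [trans]. *)
Definition t_states : list tstate :=
  t_pushes p0 o0 ++
  flat_map (fun p =>
    map (fun l => (p, [], l)) (words_upto K) ++
    flat_map (fun l => match trans p l with
                       | Some (o, p') => t_pushes p' o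
                       | None => []
                       end) (words_upto (S K))) phases.

Lemma t_states_spec p o acc :
  In (p, o, acc) t_states <->
  (acc = [] /\ p = p0 /\ In o (suffixes o0)) \/
  (o = [] /\ length acc <= K) \/
  (acc = [] /\ exists p1 l1 o1, length l1 <= S K /\ trans p1 l1 = Some (o1, p) /\
                                In o (suffixes o1)).
Proof.
  unfold t_states, t_pushes. rewrite in_app_iff, in_map_iff, in_flat_map. split.
  - intros [(o' & [= <- <- <-] & H)|(p1 & _ & H)]; [now left|right].
    apply in_app_iff in H. destruct H as [H|H].
    + apply in_map_iff in H. destruct H as (l & [= <- <- <-] & H).
      left. split; trivial. now apply words_upto_length.
    + apply in_flat_map in H. destruct H as (l & Hl & H). right.
      destruct (trans p1 l) as [[o1 p']|] eqn:E; [|destruct H].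
      apply in_map_iff in H. destruct H as (o' & [= <- <- <-] & H).
      split; trivial. exists p1, l, o1. apply words_upto_length in Hl. now repeat split.
  - intros [(-> & -> & H)|[(-> & H)|(-> & p1 & l1 & o1 & Hl & E & H)]]; [left; eauto|right|right].
    + exists p. split; [apply phases_all|]. apply in_app_iff. left.
      apply in_map_iff. exists acc. split; trivial. now apply in_words_upto.
    + exists p1. split; [apply phases_all|]. apply in_app_iff. right.
      apply in_flat_map. exists l1. split; [now apply in_words_upto|]. rewrite E.
      apply in_map_iff. now exists o.
Qed.

Lemma t_closed : q_closed tstate t_act (p0, o0, []) t_states.
Proof.
  intros [[p o] acc] H.
  assert (H' : In (p, o, acc) t_states).
  { destruct H as [[= <- <- <-]|H]; trivial. apply t_states_spec. left.
    repeat split. apply suffixes_self. }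
  clear H. apply t_states_spec in H'. destruct o as [|b o]; simpl t_act; cbv iota.
  - destruct (halted p); trivial. intro b. right.
    assert (Hacc : length acc <= K).
    { destruct H' as [(-> & _)|[(_ & H)|(-> & _)]]; simpl; trivial; lia. }
    destruct (trans p (acc ++ [b])) as [[o1 p1]|] eqn:E; apply t_states_spec.
    + right. right. split; trivial. exists p, (acc ++ [b]), o1.
      rewrite length_app. simpl. split; [lia|]. split; trivial. apply suffixes_self.
    + right. left. split; trivial.
      destruct (Nat.eq_dec (length (acc ++ [b])) (S K)) as [Hl|Hl].
      * now apply trans_total with (p := p) in Hl.
      * rewrite length_app in *. simpl in *. lia.
  - right. apply t_states_spec.
    destruct H' as [(-> & -> & H)|[([=] & _)|(-> & p1 & l1 & o1 & Hl & E & H)]].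
    + left. repeat split. now apply suffixes_tail in H.
    + right. right. split; trivial. exists p1, l1, o1. repeat split; trivial.
      now apply suffixes_tail in H.
Qed.

Definition t_tm : TM.
Proof.
  refine (q_tm tstate _ t_act (p0, o0, []) t_states). repeat decide equality.
Defined.

(** Proper prefixes get no answer from [trans], so the machine reads exactly [t]. The empty prefix
    is exempt, as [trans] is consulted only after a pop. *)
Definition token (p : P) (t o : list bool) (p' : P) : Prop :=
  t <> [] /\ halted p = false /\ trans p t = Some (o, p') /\
  forall u v, t = u ++ v -> u <> [] -> v <> [] -> trans p u = None.

Inductive reads : P -> list bool -> list bool -> P -> Prop :=
| reads_nil p : reads p [] [] p
| reads_token p t o p' w os p'' :
    token p t o p' -> reads p' w os p'' -> reads p (t ++ w) (o ++ os) p''.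

Lemma reads_app p w o p' w' o' p'' :
  reads p w o p' -> reads p' w' o' p'' -> reads p (w ++ w') (o ++ o') p''.
Proof.
  induction 1; intro; simpl; trivial. rewrite <- !app_assoc. econstructor; eauto.
Qed.

Lemma reads_one p t o p' : token p t o p' -> reads p t o p'.
Proof.
  intro H. rewrite <- (app_nil_r t), <- (app_nil_r o).
  econstructor; [exact H|constructor].
Qed.

Lemma t_run_push B p o w :
  length o + length w <= B ->
  qrun t_act B (length o) ((p, o, []), w) ((p, [], []), w ++ o).
Proof.
  revert w. induction o as [|b o IH]; intros w H; simpl in *.
  - rewrite app_nil_r. constructor.
  - econstructor; [simpl; lia|reflexivity|].
    replace (w ++ b :: o) with ((w ++ [b]) ++ o) by now rewrite <- app_assoc.
    apply IH. rewrite length_app. simpl. lia.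
Qed.

Lemma t_run_token B p t o p' w :
  token p t o p' -> length t + length w + length o <= B ->
  qrun t_act B (length t + length o) ((p, [], []), t ++ w) ((p', [], []), w ++ o).
Proof.
  intros (Hne & Hh & Ht & Hp) HB.
  assert (Hpop : forall acc t', t' <> [] -> t = acc ++ t' ->
    qrun t_act B (length t') ((p, [], acc), t' ++ w) ((p', o, []), w)).
  { intros acc t'. revert acc. induction t' as [|b t' IH]; intros acc Hn E; [contradiction|].
    assert (Hl : length (b :: t') <= length t) by (rewrite E, length_app; lia).
    econstructor.
    - cbn [snd]. rewrite length_app. lia.
    - simpl. rewrite Hh. reflexivity.
    - destruct t' as [|b' t'].
      + rewrite <- E, Ht. constructor.
      + rewrite (Hp (acc ++ [b]) (b' :: t')).
        * apply IH; [discriminate|]. now rewrite <- app_assoc.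
        * now rewrite <- app_assoc.
        * now destruct acc.
        * discriminate. }
  eapply qrun_trans; [now apply (Hpop [])|]. apply t_run_push. lia.
Qed.

Lemma t_run_reads p w o p' : reads p w o p' -> forall rest B,
  length w + length rest + length o <= B ->
  qrun t_act B (length w + length o) ((p, [], []), w ++ rest) ((p', [], []), rest ++ o).
Proof.
  induction 1 as [p|p t o p' w os p'' Ht _ IH]; intros rest B HB.
  - rewrite app_nil_r. constructor.
  - rewrite !length_app in *.
    replace (length t + length w + (length o + length os))
      with (length t + length o + (length w + length os)) by lia.
    rewrite <- (app_assoc t), (app_assoc rest). eapply qrun_trans.
    + apply t_run_token; [exact Ht|]. rewrite length_app. lia.
    + rewrite <- app_assoc. apply IH. rewrite length_app. lia.
Qed.
End Transducer.

(** * Computing the reduction by repeated passes over the queue *)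

Inductive loop : Type := LHeader1 | LHeader2 | LGates.

(* A number ending in [GrowXYZ] gains X, Y and Z per pass of the three loops, so
   that it finally has X + Y times N plus Z times the number of gates added to it. *)
Inductive growth : Type := Const | Grow100 | Grow110 | Grow120 | Grow030 | Grow131.

(* Header0/1/2 are the units of N, before and after the two loops that consume them;
   Gate0/1 precede each gate of C in the same way.  After each slot symbol, every pass
   of the first loop inserts one more gate. *)
Inductive sym : Type :=
| Header0 | Header1 | Header2
| Tick | Stop (z : growth)
| AndOp | OrOp | NotOp
| AndSlot | OrSlot | CopySlot
| Gate0 | Gate1
| End.

Definition grow (k : loop) (z : growth) : nat :=
  match k, z with
  | LHeader1, (Grow100 | Grow110 | Grow120 | Grow131) => 1
  | LHeader2, (Grow110) => 1
  | LHeader2, (Grow120) => 2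
  | LHeader2, (Grow030 | Grow131) => 3
  | LGates, Grow131 => 1
  | _, _ => 0
  end.

Definition num (c : nat) (z : growth) : list sym := repeat Tick c ++ [Stop z].

(** The numbers are the constant parts of the operands of gate j in a chain or among the copies.
    Growth supplies j during the later passes of the first loop and the multiple of N during the
    second. *)
Definition slot_gate (s : sym) : list sym :=
  match s with
  | AndSlot => AndOp :: num 1 Grow100 ++ num 2 Grow110
  | OrSlot => OrOp :: num 1 Grow100 ++ num 2 Grow120
  | CopySlot => AndOp :: num 0 Grow100 ++ num 7 Grow030
  | _ => []
  end.

Definition phi (k : loop) (s : sym) : list sym :=
  match s with
  | Stop z => num (grow k z) z
  | AndSlot | OrSlot | CopySlot =>
      s :: match k with LHeader1 => slot_gate s | _ => [] end
  | _ => [s]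
  end.

Definition unit_sym (k : loop) : sym :=
  match k with LHeader1 => Header0 | LHeader2 => Header1 | LGates => Gate0 end.

Definition sym_eq_dec (s s' : sym) : {s = s'} + {s <> s'}.
Proof. repeat decide equality. Defined.

Definition done (k : loop) (s : sym) : sym :=
  match k, s with
  | LHeader1, Header0 => Header1
  | LHeader2, Header1 => Header2
  | LGates, Gate0 => Gate1
  | _, _ => s
  end.

Definition phin (k : loop) (n : nat) (w : list sym) : list sym :=
  Nat.iter n (flat_map (phi k)) w.

Definition sym_index (s : sym) : nat :=
  match s with
  | Header0 => 0 | Header1 => 1 | Header2 => 2 | Tick => 3
  | AndOp => 4 | OrOp => 5 | NotOp => 6 | AndSlot => 7 | OrSlot => 8 | CopySlot => 9
  | Gate0 => 10 | Gate1 => 11 | End => 12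
  | Stop Const => 13 | Stop Grow100 => 14 | Stop Grow110 => 15 | Stop Grow120 => 16
  | Stop Grow030 => 17 | Stop Grow131 => 18
  end.

Definition all_syms : list sym :=
  [Header0; Header1; Header2; Tick; AndOp; OrOp; NotOp; AndSlot; OrSlot; CopySlot;
   Gate0; Gate1; End; Stop Const; Stop Grow100; Stop Grow110; Stop Grow120;
   Stop Grow030; Stop Grow131].

(** Five bits suffice for the 19 symbols, so no token is longer than five bits. *)
Definition code (s : sym) : list bool := map (Nat.testbit (sym_index s)) (seq 0 5).

Definition decode (l : list bool) : option sym :=
  find (fun s => if list_eq_dec bool_dec (code s) l then true else false) all_syms.

Lemma decode_code s : decode (code s) = Some s.
Proof. destruct s as [| | | |[]| | | | | | | | |]; reflexivity. Qed.

Definition enc (w : list sym) : list bool := flat_map code w.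

Lemma enc_app u v : enc (u ++ v) = enc u ++ enc v.
Proof. apply flat_map_app. Qed.

Lemma length_enc w : length (enc w) = 5 * length w.
Proof.
  induction w as [|s w IH]; trivial.
  change (enc (s :: w)) with (code s ++ enc w). cbn [length]. rewrite length_app, IH.
  unfold code. rewrite length_map, length_seq. lia.
Qed.

(** Each [Header2] is a 1 of the unary number of inputs; slots, gate marks and [End] leave no
    trace. *)
Definition sym_out (s : sym) : list bool :=
  match s with
  | Header2 | Tick => [true]
  | Stop _ => [false]
  | AndOp => [false; false]
  | OrOp => [false; true]
  | NotOp => [true; false]
  | _ => []
  end.

Definition out (w : list sym) : list bool := flat_map sym_out w.

(** [Grow120] yields 3N, [Grow110] yields 2N and [Grow100] yields N. *)
Definition base_word : list sym :=
  OrOp :: num 0 Const ++ num 2 Grow120 ++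
  NotOp :: num 2 Grow110 ++
  AndOp :: num 3 Grow120 ++ num 4 Grow120 ++
  AndOp :: num 1 Grow100 ++ num 5 Grow120 ++
  NotOp :: num 1 Grow100 ++
  NotOp :: num 2 Grow120 ++
  AndOp :: num 7 Grow120 ++ num 8 Grow120 ++
  OrOp :: num 6 Grow120 ++ num 9 Grow120.

(** [num 2 Const] completes the header to the unary N+2. The first gate of the conjunction chain is
    explicit, since a slot yields only N of its N+1 gates. *)
Definition head_word : list sym :=
  num 2 Const ++ AndOp :: num 0 Const ++ num 1 Grow100 ++ AndSlot :: OrSlot ::
  base_word ++ [CopySlot].

Definition final_word : list sym :=
  AndOp :: num 7 Grow120 ++ num 10 Grow131 ++ OrOp :: num 10 Grow120 ++ num 11 Grow131.

(** The offset 3N+11 arises as 11 now and 3N by growth; [Gate0] lets the third loop count the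
    gates. *)
Definition gate_word (g : gate) : list sym :=
  match g with
  | GAnd i j => Gate0 :: AndOp :: num (i + 11) Grow120 ++ num (j + 11) Grow120
  | GOr i j => Gate0 :: OrOp :: num (i + 11) Grow120 ++ num (j + 11) Grow120
  | GNot i => Gate0 :: NotOp :: num (i + 11) Grow120
  end.

(** [PNum2] and [PNum1] have two operands or one operand of a gate left to read. [PLoop k true] is a
    pass that has consumed its unit and substitutes from there on; [PLoop k false] still copies. *)
Inductive phase : Type :=
| PHead | POp | PNum2 | PNum1 | PLoop (k : loop) (marked : bool) | PFinal | PDone.

Definition phase_eq_dec (p p' : phase) : {p = p'} + {p <> p'}.
Proof. repeat decide equality. Defined.

Definition phases : list phase :=
  [PHead; POp; PNum2; PNum1; PLoop LHeader1 false; PLoop LHeader1 true;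
   PLoop LHeader2 false; PLoop LHeader2 true; PLoop LGates false; PLoop LGates true;
   PFinal; PDone].

Lemma phases_all p : In p phases.
Proof. destruct p as [| | | |[] []| |]; simpl; tauto. Qed.

Definition next_phase (k : loop) : phase :=
  match k with
  | LHeader1 => PLoop LHeader2 false
  | LHeader2 => PLoop LGates false
  | LGates => PFinal
  end.

Definition sym_trans (p : phase) (s : sym) : list bool * phase :=
  match p with
  | PLoop k marked =>
      if sym_eq_dec s End then (code End, if marked then PLoop k false else next_phase k)
      else if marked then (enc (phi k s), p)
      else if sym_eq_dec s (unit_sym k) then (code (done k s), PLoop k true)
      else (code s, p)
  | PFinal => (sym_out s, if sym_eq_dec s End then PDone else PFinal)
  | _ => ([], PDone)
  end.

Definition block_trans (p : phase) (l : list bool) : option (list bool * phase) :=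
  if length l <? 5 then None
  else match decode l with
       | Some s => Some (sym_trans p s)
       | None => Some ([], PDone)
       end.

(* Words that no input produces are sent to PDone. *)
Definition trans (p : phase) (l : list bool) : option (list bool * phase) :=
  match p, l with
  | PHead, [true] => Some (code Header0, PHead)
  | PHead, [false] => Some (enc head_word, POp)
  | POp, ([] | [_]) => None
  | POp, [false; false] => Some (enc [Gate0; AndOp], PNum2)
  | POp, [false; true] => Some (enc [Gate0; OrOp], PNum2)
  | POp, [true; false] => Some (enc [Gate0; NotOp], PNum1)
  | POp, [true; true] => Some (enc (final_word ++ [End]), PLoop LHeader1 false)
  | PNum2, [true] => Some (enc [Tick], PNum2)
  | PNum2, [false] => Some (enc (num 11 Grow120), PNum1)
  | PNum1, [true] => Some (enc [Tick], PNum1)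
  | PNum1, [false] => Some (enc (num 11 Grow120), POp)
  | (PLoop _ _ | PFinal), _ => block_trans p l
  | _, _ => Some ([], PDone)
  end.

Definition halted (p : phase) : bool := match p with PDone => true | _ => false end.

Lemma trans_total p l : length l = 5 -> trans p l <> None.
Proof.
  intros Hl. destruct l as [|b1 [|b2 [|b3 l]]]; [discriminate..|].
  destruct p; simpl; try discriminate; try (destruct b1, b2; discriminate);
    unfold block_trans; rewrite Hl; simpl Nat.ltb; cbv iota; destruct (decode _); discriminate.
Qed.

(** * Single passes over the queue *)

Local Notation phase_reads := (reads phase trans halted).

Lemma reads_bit p b o p' :
  halted p = false -> trans p [b] = Some (o, p') -> phase_reads p [b] o p'.
Proof.
  intros Hh Ht. apply reads_one. repeat split; trivial; [discriminate|].
  intros [|b1 u] v E Hu Hv; [contradiction|]. destruct u, v; try discriminate. contradiction.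
Qed.

Lemma reads_op b b' o p' : trans POp [b; b'] = Some (o, p') -> phase_reads POp [b; b'] o p'.
Proof.
  intros Ht. apply reads_one. repeat split; trivial; [discriminate|].
  intros [|b1 [|b2 u]] v E Hu Hv; [contradiction|now destruct b1|].
  destruct u, v; try discriminate. contradiction.
Qed.

Lemma reads_ticks p n :
  halted p = false -> trans p [true] = Some (enc [Tick], p) ->
  phase_reads p (repeat true n) (enc (repeat Tick n)) p.
Proof.
  intros Hh Ht. induction n as [|n IH]; [constructor|].
  apply (reads_app _ _ _ p [true] (enc [Tick]) p); trivial. now apply reads_bit.
Qed.

Lemma reads_num p p' n :
  halted p = false -> trans p [true] = Some (enc [Tick], p) ->
  trans p [false] = Some (enc (num 11 Grow120), p') ->
  phase_reads p (enc_nat n) (enc (num (n + 11) Grow120)) p'.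
Proof.
  intros Hh Ht Hf. unfold enc_nat, num. rewrite repeat_app, <- app_assoc, enc_app.
  eapply reads_app; [now apply reads_ticks|now apply reads_bit].
Qed.

Lemma reads_gates gs :
  phase_reads POp (flat_map enc_gate gs) (enc (flat_map gate_word gs)) POp.
Proof.
  induction gs as [|g gs IH]; [constructor|]. cbn [flat_map]. rewrite enc_app.
  eapply reads_app; [|exact IH].
  destruct g as [i j|i j|i]; cbn [enc_gate gate_word].
  - change (Gate0 :: AndOp :: ?w) with ([Gate0; AndOp] ++ w). rewrite !enc_app.
    eapply reads_app; [apply reads_op; reflexivity|].
    eapply reads_app; apply reads_num; reflexivity.
  - change (Gate0 :: OrOp :: ?w) with ([Gate0; OrOp] ++ w). rewrite !enc_app.
    eapply reads_app; [apply reads_op; reflexivity|].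
    eapply reads_app; apply reads_num; reflexivity.
  - change (Gate0 :: NotOp :: ?w) with ([Gate0; NotOp] ++ w). rewrite !enc_app.
    eapply reads_app; [apply reads_op; reflexivity|]. apply reads_num; reflexivity.
Qed.

Definition input_word (C : circuit) : list sym :=
  head_word ++ flat_map gate_word (c_gates C).

(** The word 11, pushed at the start, is no operation code and so marks the end of the circuit;
    there the final gates and [End] are added. *)
Lemma reads_input C :
  phase_reads PHead (enc_circuit C ++ [true; true])
    (enc (repeat Header0 (c_inputs C) ++ (input_word C ++ final_word) ++ [End]))
    (PLoop LHeader1 false).
Proof.
  unfold enc_circuit, enc_nat, input_word. rewrite <- !app_assoc, !enc_app.
  eapply reads_app with (p' := PHead).
  { induction (c_inputs C) as [|n IH]; [constructor|].
    apply (reads_app _ _ _ PHead [true] (code Header0) PHead); [|exact IH].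
    now apply reads_bit. }
  eapply reads_app with (p' := POp); [now apply reads_bit|].
  eapply reads_app; [apply reads_gates|].
  rewrite <- enc_app. now apply reads_op.
Qed.

Definition block_phase (p : phase) : bool :=
  match p with PLoop _ _ | PFinal => true | _ => false end.

Lemma reads_sym p s o p' :
  block_phase p = true -> sym_trans p s = (o, p') -> phase_reads p (code s) o p'.
Proof.
  intros Hp Hs. apply reads_one. assert (Ht : trans p (code s) = block_trans p (code s))
    by (destruct p; trivial; discriminate).
  repeat split.
  - discriminate.
  - destruct p; trivial; discriminate.
  - rewrite Ht. unfold block_trans. now rewrite decode_code, Hs.
  - intros u v E Hu Hv. assert (Hl : length u < 5).
    { apply (f_equal (@length bool)) in E. rewrite length_app in E.
      destruct v; [contradiction|]. simpl length in E. lia. }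
    apply Nat.ltb_lt in Hl.
    destruct p; try discriminate; cbn [trans]; unfold block_trans; now rewrite Hl.
Qed.

Lemma reads_map p f w :
  block_phase p = true -> (forall s, In s w -> sym_trans p s = (f s, p)) ->
  phase_reads p (enc w) (flat_map f w) p.
Proof.
  intros Hp. induction w as [|s w IH]; intro H; [constructor|].
  cbn [enc flat_map]. eapply reads_app.
  - apply reads_sym; trivial. apply H. now left.
  - apply IH. intros s' Hs'. apply H. now right.
Qed.

Lemma reads_marked k w : ~ In End w ->
  phase_reads (PLoop k true) (enc w) (enc (flat_map (phi k) w)) (PLoop k true).
Proof.
  intro H. unfold enc at 2.
  replace (flat_map code (flat_map (phi k) w)) with (flat_map (fun s => enc (phi k s)) w).
  - apply reads_map; trivial. intros s Hs. simpl.
    destruct (sym_eq_dec s End) as [->|]; [contradiction|reflexivity].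
  - induction w as [|s w IH]; trivial. cbn [flat_map]. rewrite flat_map_app, IH; trivial.
    intro. apply H. now right.
Qed.

Lemma reads_unmarked k w : ~ In End w -> ~ In (unit_sym k) w ->
  phase_reads (PLoop k false) (enc w) (enc w) (PLoop k false).
Proof.
  intros He Hu. apply reads_map; trivial. intros s Hs. simpl.
  destruct (sym_eq_dec s End) as [->|]; [contradiction|].
  destruct (sym_eq_dec s (unit_sym k)) as [->|]; [contradiction|reflexivity].
Qed.

Lemma reads_pass k u v : ~ In End u -> ~ In (unit_sym k) u -> ~ In End v ->
  phase_reads (PLoop k false) (enc (u ++ [unit_sym k] ++ v ++ [End]))
    (enc (u ++ [done k (unit_sym k)] ++ flat_map (phi k) v ++ [End])) (PLoop k false).
Proof.
  intros H1 H2 H3. rewrite !enc_app.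
  eapply reads_app; [now apply reads_unmarked|].
  eapply reads_app with (p' := PLoop k true); [|eapply reads_app; [now apply reads_marked|]].
  - cbn [enc flat_map]. rewrite !app_nil_r. apply reads_sym; trivial.
    destruct k; reflexivity.
  - now apply reads_sym.
Qed.

Lemma reads_last_pass k u : ~ In End u -> ~ In (unit_sym k) u ->
  phase_reads (PLoop k false) (enc (u ++ [End])) (enc (u ++ [End])) (next_phase k).
Proof.
  intros H1 H2. rewrite !enc_app.
  eapply reads_app; [now apply reads_unmarked|now apply reads_sym].
Qed.

Lemma reads_final u : ~ In End u -> phase_reads PFinal (enc (u ++ [End])) (out u) PDone.
Proof.
  intros H1. rewrite enc_app, <- (app_nil_r (out u)).
  eapply reads_app with (p' := PFinal); [|now apply reads_sym].
  apply reads_map; trivial. intros s Hs. simpl.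
  destruct (sym_eq_dec s End) as [->|]; [contradiction|reflexivity].
Qed.

(** * Iterated substitution *)

Lemma phin_succ k n w : phin k (S n) w = phin k n (flat_map (phi k) w).
Proof. unfold phin. now rewrite Nat.iter_succ_r. Qed.

Lemma phin_nil k n : phin k n [] = [].
Proof. induction n; trivial. now rewrite phin_succ. Qed.

Lemma phin_app k n u v : phin k n (u ++ v) = phin k n u ++ phin k n v.
Proof.
  revert u v. induction n as [|n IH]; intros u v; trivial.
  now rewrite !phin_succ, flat_map_app, IH.
Qed.

Lemma phin_fixed k n s : phi k s = [s] -> phin k n [s] = [s].
Proof.
  intro H. induction n as [|n IH]; trivial. rewrite phin_succ. simpl. now rewrite H, app_nil_r.
Qed.

Lemma phin_cons k n s w : phi k s = [s] -> phin k n (s :: w) = s :: phin k n w.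
Proof. intro H. change (s :: w) with ([s] ++ w). now rewrite phin_app, phin_fixed. Qed.

Lemma phin_ticks k n c : phin k n (repeat Tick c) = repeat Tick c.
Proof.
  induction c as [|c IH]; cbn [repeat]; [apply phin_nil|]. now rewrite phin_cons, IH.
Qed.

Lemma phin_num k n c z : phin k n (num c z) = num (c + n * grow k z) z.
Proof.
  unfold num. rewrite phin_app, phin_ticks, repeat_app, <- app_assoc. f_equal.
  induction n as [|n IH]; trivial. rewrite phin_succ. cbn [flat_map phi]. rewrite app_nil_r.
  unfold num. rewrite phin_app, phin_ticks, IH. cbn [Nat.mul].
  now rewrite repeat_app, <- app_assoc.
Qed.

(** Every pass of the first loop inserts a gate right behind the slot and substitutes in the older
    ones. Newer gates thus come first, and gate j, counted from 0, has undergone j passes. *)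
Lemma phin_slot k n s : In s [AndSlot; OrSlot; CopySlot] ->
  phin k n [s] = s :: match k with
                      | LHeader1 => flat_map (fun j => phin k j (slot_gate s)) (seq 0 n)
                      | _ => []
                      end.
Proof.
  intro Hs.
  assert (Hphi : phi k s = [s] ++ match k with LHeader1 => slot_gate s | _ => [] end)
    by (destruct Hs as [<-|[<-|[<-|[]]]]; reflexivity).
  induction n as [|n IH]; [now destruct k|].
  rewrite phin_succ. cbn [flat_map]. rewrite app_nil_r, Hphi, phin_app, IH.
  destruct k; [|now rewrite phin_nil..].
  rewrite seq_S, flat_map_app. simpl. now rewrite app_nil_r.
Qed.

Lemma out_app u v : out (u ++ v) = out u ++ out v.
Proof. apply flat_map_app. Qed.

Lemma out_num c z : out (num c z) = enc_nat c.
Proof.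
  unfold num, enc_nat. rewrite out_app. f_equal.
  induction c as [|c IH]; trivial. cbn [repeat]. now rewrite <- IH.
Qed.

Lemma out_done w : out (map (done LGates) w) = out w.
Proof.
  induction w as [|s w IH]; trivial. cbn [map out flat_map]. fold (out w).
  unfold out in IH at 1. rewrite IH. now destruct s.
Qed.

(** * The word produced by the passes *)

Section Output.
Variables N G : nat.

Definition grown (w : list sym) : list sym := phin LHeader2 N (phin LHeader1 N w).

Lemma grown_app u v : grown (u ++ v) = grown u ++ grown v.
Proof. unfold grown. now rewrite !phin_app. Qed.

Lemma out_grown_app u v : out (grown (u ++ v)) = out (grown u) ++ out (grown v).
Proof. now rewrite grown_app, out_app. Qed.

Lemma out_grown_cons s w : (forall k, phi k s = [s]) ->
  out (grown (s :: w)) = sym_out s ++ out (grown w).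
Proof. intro H. unfold grown. now rewrite !phin_cons by apply H. Qed.

Lemma out_grown_num c z :
  out (grown (num c z)) = enc_nat (c + N * (grow LHeader1 z + grow LHeader2 z)).
Proof. unfold grown. rewrite !phin_num, out_num. f_equal. lia. Qed.

Lemma out_phin_flat_map {A} k n (f : A -> list sym) l :
  out (phin k n (flat_map f l)) = flat_map (fun a => out (phin k n (f a))) l.
Proof.
  induction l as [|a l IH]; cbn [flat_map]; [now rewrite phin_nil|].
  now rewrite phin_app, out_app, IH.
Qed.

Lemma flat_map_enc_gate_map {A} (f : A -> gate) g l :
  (forall a, enc_gate (f a) = g a) -> flat_map g l = flat_map enc_gate (map f l).
Proof.
  intro H. induction l as [|a l IH]; trivial. cbn [flat_map map]. now rewrite IH, H.
Qed.

Lemma out_grown_slot s f : In s [AndSlot; OrSlot; CopySlot] ->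
  (forall j, out (phin LHeader2 N (phin LHeader1 j (slot_gate s))) = enc_gate (f j)) ->
  out (grown [s]) = flat_map enc_gate (map f (seq 0 N)).
Proof.
  intros Hs Hf. unfold grown. rewrite phin_slot by exact Hs.
  change (s :: ?w) with ([s] ++ w). rewrite phin_app, out_app, phin_slot by exact Hs.
  rewrite out_phin_flat_map.
  replace (out [s]) with (@nil bool) by (destruct Hs as [<-|[<-|[<-|[]]]]; reflexivity).
  apply flat_map_enc_gate_map. intro j. symmetry. apply Hf.
Qed.

Lemma enc_and i j i' j' : i = i' -> j = j' ->
  [false; false] ++ enc_nat i ++ enc_nat j = enc_gate (GAnd i' j').
Proof. now intros -> ->. Qed.
Lemma enc_or i j i' j' : i = i' -> j = j' ->
  [false; true] ++ enc_nat i ++ enc_nat j = enc_gate (GOr i' j').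
Proof. now intros -> ->. Qed.
Lemma out_grown_and_slot :
  out (grown [AndSlot]) = flat_map enc_gate (map (fun j => GAnd (1 + j) (N + 2 + j)) (seq 0 N)).
Proof.
  apply out_grown_slot; [simpl; tauto|]. intro j. cbn [slot_gate].
  rewrite !phin_cons, !phin_app, !phin_num by reflexivity.
  change (out (AndOp :: ?w)) with ([false; false] ++ out w).
  rewrite out_app, !out_num. apply enc_and; cbn [grow]; lia.
Qed.

Lemma out_grown_or_slot :
  out (grown [OrSlot]) = flat_map enc_gate (or_chain N).
Proof.
  apply out_grown_slot; [simpl; tauto|]. intro j. cbn [slot_gate].
  rewrite !phin_cons, !phin_app, !phin_num by reflexivity.
  change (out (OrOp :: ?w)) with ([false; true] ++ out w).
  rewrite out_app, !out_num. apply enc_or; cbn [grow]; lia.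
Qed.

Lemma out_grown_copy_slot :
  out (grown [CopySlot]) = flat_map enc_gate (input_copies N).
Proof.
  apply out_grown_slot; [simpl; tauto|]. intro j. cbn [slot_gate].
  rewrite !phin_cons, !phin_app, !phin_num by reflexivity.
  change (out (AndOp :: ?w)) with ([false; false] ++ out w).
  rewrite out_app, !out_num. apply enc_and; cbn [grow]; lia.
Qed.

Ltac grown_gates :=
  assert (Ec : forall c, c + N * (0 + 0) = c) by (intro; lia);
  assert (E1 : forall c, c + N * (1 + 0) = N + c) by (intro; lia);
  assert (E2 : forall c, c + N * (1 + 1) = 2 * N + c) by (intro; lia);
  assert (E3 : forall c, c + N * (1 + 2) = 3 * N + c) by (intro; lia);
  assert (E4 : forall c, c + N * (1 + 3) = 4 * N + c) by (intro; lia);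
  repeat first [ rewrite out_grown_cons by (intros []; reflexivity)
               | rewrite out_grown_app | rewrite out_grown_num ];
  cbn [sym_out grow]; rewrite ?Ec, ?E1, ?E2, ?E3, ?E4.

Lemma out_grown_base : out (grown base_word) = flat_map enc_gate (base_gates N).
Proof.
  unfold base_word, base_gates. cbn [flat_map enc_gate]. rewrite ?app_nil_r.
  grown_gates. now rewrite <- !app_assoc.
Qed.

Lemma out_grown_head :
  out (grown head_word) =
  [true; true; false] ++ flat_map enc_gate (and_chain N ++ or_chain N ++ base_gates N ++ input_copies N).
Proof.
  assert (Ea : and_chain N = GAnd 0 (N + 1) :: map (fun j => GAnd (1 + j) (N + 2 + j)) (seq 0 N)).
  { unfold and_chain. rewrite Nat.add_1_r. cbn [seq map]. f_equal; [f_equal; lia|].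
    rewrite <- seq_shift, map_map. apply map_ext. intro j. f_equal; lia. }
  rewrite Ea, !flat_map_app. cbn [flat_map enc_gate].
  rewrite <- out_grown_and_slot, <- out_grown_or_slot, <- out_grown_base, <- out_grown_copy_slot.
  unfold head_word.
  change (AndSlot :: OrSlot :: ?w) with ([AndSlot] ++ [OrSlot] ++ w).
  grown_gates. now rewrite <- !app_assoc.
Qed.

Lemma out_grown_gate g : out (grown (gate_word g)) = enc_gate (shift_gate (3 * N + 11) g).
Proof.
  assert (E : forall i, i + (3 * N + 11) = 3 * N + (i + 11)) by (intro; lia).
  destruct g as [i j|i j|i]; cbn [gate_word shift_gate]; rewrite !E; clear E;
    now grown_gates.
Qed.

Lemma out_grown_gates gs :
  out (grown (flat_map gate_word gs)) =
  flat_map enc_gate (map (shift_gate (3 * N + 11)) gs).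
Proof.
  induction gs as [|g gs IH]; cbn [flat_map map]; [unfold grown; now rewrite !phin_nil|].
  now rewrite out_grown_app, IH, out_grown_gate.
Qed.

Lemma out_final :
  out (phin LGates G (grown final_word)) = flat_map enc_gate (final_gates N G).
Proof.
  unfold grown, final_word.
  repeat first [ rewrite phin_cons by reflexivity | rewrite phin_app | rewrite phin_num ].
  change (out (?s :: ?w)) with (sym_out s ++ out w).
  cbn [final_gates flat_map enc_gate]. rewrite ?app_nil_r.
  repeat first [ rewrite out_app | rewrite out_num ].
  change (out (?s :: ?w)) with (sym_out s ++ out w).
  rewrite out_app, !out_num. cbn [sym_out grow].
  replace (7 + N * 1 + N * 2 + G * 0) with (3 * N + 7) by lia.
  replace (10 + N * 1 + N * 3 + G * 1) with (4 * N + 10 + G) by lia.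
  replace (10 + N * 1 + N * 2 + G * 0) with (3 * N + 10) by lia.
  replace (11 + N * 1 + N * 3 + G * 1) with (4 * N + 11 + G) by lia.
  now rewrite <- !app_assoc.
Qed.
End Output.

(** The third loop, with one unit per gate of C, merely marks gates in the first part, because
    numbers growing in that loop occur in [final_word] alone. *)
Definition result_word (C : circuit) : list sym :=
  let N := c_inputs C in
  map (done LGates) (repeat Header2 N ++ grown N (input_word C)) ++
  phin LGates (length (c_gates C)) (grown N final_word).

Lemma out_result C : out (result_word C) = enc_circuit (test_circuit C).
Proof.
  destruct C as [N gs]. unfold result_word, input_word, test_circuit, enc_circuit, enc_nat.
  cbn [c_inputs c_gates].
  rewrite out_app, out_done, out_app, out_grown_app, out_grown_head, out_grown_gates, out_final.
  replace (out (repeat Header2 N)) with (repeat true N)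
    by (induction N as [|N IH]; trivial; cbn [repeat]; now rewrite IH).
  rewrite repeat_app, !flat_map_app, <- !app_assoc. reflexivity.
Qed.

(** * Execution of the loops *)

Definition clean (k : loop) (s : sym) : bool :=
  if sym_eq_dec s End then false else if sym_eq_dec s (unit_sym k) then false else true.

Lemma clean_phi k k' s : clean k s = true -> forallb (clean k) (phi k' s) = true.
Proof. destruct k, k', s as [| | | |[]| | | | | | | | |]; (reflexivity || discriminate). Qed.

Lemma clean_not_in k w : forallb (clean k) w = true -> ~ In End w /\ ~ In (unit_sym k) w.
Proof.
  rewrite forallb_forall. unfold clean. split; intro H'; apply H in H'.
  - discriminate.
  - destruct (sym_eq_dec (unit_sym k) End); [discriminate|].
    destruct (sym_eq_dec (unit_sym k) (unit_sym k)); [discriminate|contradiction].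
Qed.

Lemma forallb_flat_map {A B} (p : A -> bool) (q : B -> bool) (f : A -> list B) l :
  (forall a, p a = true -> forallb q (f a) = true) ->
  forallb p l = true -> forallb q (flat_map f l) = true.
Proof.
  intros H. induction l as [|a l IH]; trivial. cbn [forallb flat_map].
  rewrite andb_true_iff, forallb_app. intros [Ha Hl]. now rewrite H, IH.
Qed.

Lemma forallb_phin (p : sym -> bool) k n w :
  (forall s, p s = true -> forallb p (phi k s) = true) ->
  forallb p w = true -> forallb p (phin k n w) = true.
Proof.
  intro H. revert w. induction n as [|n IH]; intros w Hw; trivial.
  rewrite phin_succ. apply IH. now apply (forallb_flat_map p).
Qed.

Lemma count_first_split k w n :
  count_occ sym_eq_dec w (unit_sym k) = S n ->
  exists u v, w = u ++ [unit_sym k] ++ v /\ ~ In (unit_sym k) u /\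
              count_occ sym_eq_dec v (unit_sym k) = n.
Proof.
  induction w as [|s w IH]; [discriminate|]. cbn [count_occ].
  destruct (sym_eq_dec s (unit_sym k)) as [->|Hne]; intro H.
  - exists [], w. injection H as H. repeat split; auto.
  - destruct (IH H) as (u & v & -> & Hu & Hv). exists (s :: u), v. repeat split; trivial.
    intros [E|E]; contradiction.
Qed.

Lemma length_flat_map_le {A B} (f : A -> list B) l :
  (forall a, 1 <= length (f a)) -> length l <= length (flat_map f l).
Proof.
  intro H. induction l as [|a l IH]; simpl; trivial. rewrite length_app. specialize (H a). lia.
Qed.

(** Intermediate words are thus no longer than the final one, whose length yields the bound on the
    queue. *)
Lemma length_phin_ge k n w : length w <= length (phin k n w).
Proof.
  revert w. induction n as [|n IH]; intro w; trivial. rewrite phin_succ.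
  etransitivity; [|apply IH]. apply length_flat_map_le.
  intro s. destruct s; simpl; try lia. unfold num. rewrite length_app. simpl. lia.
Qed.

Lemma done_not_unit k s : s <> unit_sym k -> done k s = s.
Proof. destruct k, s; trivial; contradiction. Qed.

Lemma done_done k s : done k (done k s) = done k s.
Proof. now destruct k, s. Qed.

Local Notation run := (qrun (t_act phase trans halted)).

Lemma run_reads B p w o p' :
  phase_reads p w o p' -> length w + length o <= B ->
  exists t, t <= B /\ run B t ((p, [], []), w) ((p', [], []), o).
Proof.
  intros H HB. exists (length w + length o). split; [exact HB|].
  pose proof (t_run_reads _ _ _ _ _ _ _ H [] B) as H'. rewrite app_nil_r in H'.
  apply H'. simpl. lia.
Qed.

(** The units lie in [y], which the substitution fixes, so only [X] grows even though a pass
    substitutes just behind its unit. There are n consuming passes and a last one that finds no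
    unit; each reads and writes five bits per symbol, whence the factor 10. *)
Lemma run_loop k B n y X :
  count_occ sym_eq_dec y (unit_sym k) = n ->
  (forall s, In s y -> phi k s = [s] /\ s <> End) ->
  forallb (clean k) X = true ->
  10 * length (map (done k) y ++ phin k n X ++ [End]) <= B ->
  exists t, t <= (n + 1) * B /\
    run B t ((PLoop k false, [], []), enc (y ++ X ++ [End]))
      ((next_phase k, [], []), enc (map (done k) y ++ phin k n X ++ [End])).
Proof.
  revert y X. induction n as [|n IH]; intros y X Hc Hy HX HB.
  - assert (Hn : ~ In (unit_sym k) y) by now apply count_occ_not_In in Hc.
    replace (map (done k) y) with y in *.
    + destruct (run_reads B (PLoop k false) (enc (y ++ X ++ [End])) (enc (y ++ X ++ [End]))
        (next_phase k)) as (t & Ht & Hr).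
      * rewrite app_assoc. destruct (clean_not_in _ _ HX) as [H1 H2].
        apply reads_last_pass; rewrite in_app_iff; intros [H|H]; try contradiction.
        now apply Hy in H.
      * rewrite length_enc. change (phin k 0 X) with X in HB. lia.
      * exists t. split; [lia|exact Hr].
    + symmetry. rewrite <- (map_id y) at 2. apply map_ext_in. intros s Hs.
      apply done_not_unit. now intros ->.
  - destruct (count_first_split _ _ _ Hc) as (u & v & -> & Hu & Hv).
    set (y' := u ++ [done k (unit_sym k)] ++ v).
    assert (Em : map (done k) (u ++ [unit_sym k] ++ v) = map (done k) y').
    { unfold y'. rewrite !map_app. simpl. now rewrite done_done. }
    rewrite Em, phin_succ in *.
    assert (Ev : flat_map (phi k) v = v).
    { assert (Hv' : forall s, In s v -> phi k s = [s])
        by (intros s Hs; apply Hy; rewrite !in_app_iff; tauto).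
      clear -Hv'. induction v as [|s v IH]; trivial. cbn [flat_map].
      rewrite Hv', IH by (auto using in_eq, in_cons). reflexivity. }
    destruct (clean_not_in _ _ HX) as [H1 H2].
    destruct (run_reads B (PLoop k false) (enc ((u ++ [unit_sym k] ++ v) ++ X ++ [End]))
      (enc (y' ++ flat_map (phi k) X ++ [End])) (PLoop k false)) as (t1 & Ht1 & Hr1).
    + unfold y'. rewrite <- !app_assoc.
      pose proof (reads_pass k u (v ++ X)) as Hp. rewrite flat_map_app, Ev, <- !app_assoc in Hp.
      apply Hp; trivial.
      * intro Hin. apply (Hy End); [rewrite !in_app_iff; tauto|reflexivity].
      * rewrite in_app_iff. intros [Hin|Hin]; [|contradiction].
        apply (Hy End); [rewrite !in_app_iff; tauto|reflexivity].
    + rewrite !length_enc. pose proof (length_phin_ge k n (flat_map (phi k) X)) as Hl.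
      assert (Hl' : length X <= length (flat_map (phi k) X))
        by apply (length_phin_ge k 1 X).
      unfold y' in *. rewrite !length_app, !length_map, !length_app in *. cbn [length] in *. lia.
    + destruct (IH y' (flat_map (phi k) X)) as (t2 & Ht2 & Hr2).
      * unfold y'. rewrite !count_occ_app, Hv. apply (count_occ_not_In sym_eq_dec) in Hu.
        rewrite Hu. now destruct k.
      * unfold y'. intros s Hs. rewrite !in_app_iff in Hs. destruct Hs as [Hs|[[<-|[]]|Hs]].
        -- apply Hy. rewrite !in_app_iff. tauto.
        -- now destruct k.
        -- apply Hy. rewrite !in_app_iff. tauto.
      * apply (forallb_flat_map (clean k)); trivial. apply clean_phi.
      * exact HB.
      * exists (t1 + t2). split; [lia|]. eapply qrun_trans; eassumption.
Qed.

(** Selects the symbols, other than [End], that the substitution of the third loop fixes. *)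
Definition no_grow131 (s : sym) : bool :=
  match s with End | Stop Grow131 => false | _ => true end.

Lemma no_grow131_phi k s : no_grow131 s = true -> forallb no_grow131 (phi k s) = true.
Proof. destruct k, s as [| | | |[]| | | | | | | | |]; (reflexivity || discriminate). Qed.

Lemma no_grow131_fixed s : no_grow131 s = true -> phi LGates s = [s] /\ s <> End.
Proof. destruct s as [| | | |[]| | | | | | | | |]; split; (reflexivity || discriminate). Qed.

Lemma forallb_num p c z :
  p Tick = true -> p (Stop z) = true -> forallb p (num c z) = true.
Proof.
  intros Ht Hz. unfold num. rewrite forallb_app. cbn [forallb]. rewrite Hz, !andb_true_r.
  induction c as [|c IH]; trivial. cbn [repeat forallb]. now rewrite Ht, IH.
Qed.

Lemma forallb_gate_words (p : sym -> bool) gs :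
  forallb p [Gate0; AndOp; OrOp; NotOp; Tick; Stop Grow120] = true ->
  forallb p (flat_map gate_word gs) = true.
Proof.
  simpl. rewrite !andb_true_iff. intros (H0 & H1 & H2 & H3 & H4 & H5 & _).
  apply (forallb_flat_map (fun _ => true)); [|now induction gs].
  intros g _. destruct g; cbn [gate_word forallb];
    rewrite ?forallb_app, ?forallb_num, ?H0, ?H1, ?H2, ?H3 by trivial; reflexivity.
Qed.

Lemma forallb_input_word (p : sym -> bool) C :
  forallb p head_word = true ->
  forallb p [Gate0; AndOp; OrOp; NotOp; Tick; Stop Grow120] = true ->
  forallb p (input_word C) = true.
Proof.
  intros H1 H2. unfold input_word. now rewrite forallb_app, H1, forallb_gate_words.
Qed.

(** Gates inserted at slots bear no [Gate0], so the third loop finds one unit per gate of C. *)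
Lemma count_gates_phin k n w :
  count_occ sym_eq_dec (phin k n w) Gate0 = count_occ sym_eq_dec w Gate0.
Proof.
  assert (H : forall w, count_occ sym_eq_dec (flat_map (phi k) w) Gate0 =
                        count_occ sym_eq_dec w Gate0).
  { intro u. induction u as [|s u IH]; trivial. cbn [flat_map].
    rewrite count_occ_app, IH. destruct k, s as [| | | |[]| | | | | | | | |]; reflexivity. }
  revert w. induction n as [|n IH]; intro w; trivial. now rewrite phin_succ, IH, H.
Qed.

Lemma count_gates_input C : count_occ sym_eq_dec (input_word C) Gate0 = length (c_gates C).
Proof.
  assert (Hn : forall c z, count_occ sym_eq_dec (num c z) Gate0 = 0).
  { intros c z. unfold num. now rewrite count_occ_app, count_occ_repeat_neq. }
  unfold input_word. rewrite count_occ_app.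
  change (count_occ sym_eq_dec head_word Gate0) with 0. simpl.
  induction (c_gates C) as [|g gs IH]; trivial. cbn [flat_map].
  rewrite count_occ_app, IH. destruct g; cbn [gate_word];
    rewrite !count_occ_cons_eq by trivial; rewrite !count_occ_cons_neq by discriminate;
    rewrite ?count_occ_app, !Hn; reflexivity.
Qed.

Lemma map_done_header k n :
  map (done k) (repeat (unit_sym k) n) = repeat (done k (unit_sym k)) n.
Proof. apply map_repeat. Qed.

Lemma run_machine C B :
  let L := length (enc_circuit C) in
  L + 2 + 10 * (length (result_word C) + 1) <= B ->
  exists t, t <= (2 * c_inputs C + length (c_gates C) + 7) * B /\
    run B t ((PHead, [true; true], []), enc_circuit C)
      ((PDone, [], []), enc_circuit (test_circuit C)).
Proof.
  intros L HB. rewrite <- out_result.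
  set (N := c_inputs C) in *. set (G := length (c_gates C)).
  set (X := input_word C ++ final_word).
  assert (Hlen : length (repeat Header2 N ++ grown N X) <= length (result_word C)).
  { unfold result_word, X. rewrite grown_app, !length_app, length_map, length_app. fold N.
    pose proof (length_phin_ge LGates (length (c_gates C)) (grown N final_word)). lia. }
  rewrite length_app, repeat_length in Hlen.
  pose proof (length_phin_ge LHeader1 N X) as Hl1.
  pose proof (length_phin_ge LHeader2 N (phin LHeader1 N X)) as Hl2. fold (grown N X) in Hl2.
  assert (Hinit : run B 2 ((PHead, [true; true], []), enc_circuit C)
                          ((PHead, [], []), enc_circuit C ++ [true; true])).
  { apply (t_run_push _ _ _ B PHead [true; true] (enc_circuit C)). simpl. unfold L in HB. lia. }
  destruct (run_reads B _ _ _ _ (reads_input C)) as (t0 & Ht0 & H0).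
  { rewrite length_enc. fold X N. rewrite !length_app, repeat_length. cbn [length]. fold L. lia. }
  fold X N in H0.
  destruct (run_loop LHeader1 B N (repeat Header0 N) X) as (t1 & Ht1 & H1).
  { apply count_occ_repeat_eq. reflexivity. }
  { intros s Hs. apply repeat_spec in Hs. subst s. split; [reflexivity|discriminate]. }
  { unfold X. rewrite forallb_app, forallb_input_word by reflexivity. reflexivity. }
  { rewrite !length_app, length_map, repeat_length. cbn [length]. lia. }
  change (repeat Header0 N) with (repeat (unit_sym LHeader1) N) in H1 at 2.
  rewrite map_done_header in H1. cbn [done unit_sym next_phase] in H1.
  destruct (run_loop LHeader2 B N (repeat Header1 N) (phin LHeader1 N X)) as (t2 & Ht2 & H2).
  { apply count_occ_repeat_eq. reflexivity. }
  { intros s Hs. apply repeat_spec in Hs. subst s. split; [reflexivity|discriminate]. }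
  { apply forallb_phin; [apply clean_phi|].
    unfold X. rewrite forallb_app, forallb_input_word by reflexivity. reflexivity. }
  { fold (grown N X). rewrite !length_app, length_map, repeat_length. cbn [length]. lia. }
  change (repeat Header1 N) with (repeat (unit_sym LHeader2) N) in H2 at 2.
  rewrite map_done_header in H2. cbn [done unit_sym next_phase] in H2.
  fold (grown N X) in H2.
  assert (Hok : forallb no_grow131 (grown N (input_word C)) = true).
  { unfold grown. do 2 (apply forallb_phin; [apply no_grow131_phi|]).
    now apply forallb_input_word. }
  (* Now the units lie inside the grown input word, and only the final gates are left to grow. *)
  destruct (run_loop LGates B G (repeat Header2 N ++ grown N (input_word C)) (grown N final_word))
    as (t3 & Ht3 & H3).
  { rewrite count_occ_app, count_occ_repeat_neq by discriminate. unfold grown. cbn [unit_sym].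
    rewrite !count_gates_phin. apply count_gates_input. }
  { intros s Hs. apply in_app_iff in Hs. destruct Hs as [Hs|Hs].
    - apply repeat_spec in Hs. subst s. split; [reflexivity|discriminate].
    - rewrite forallb_forall in Hok. now apply no_grow131_fixed, Hok. }
  { unfold grown. do 2 (apply forallb_phin; [apply clean_phi|]). reflexivity. }
  { rewrite app_assoc. change (map _ _ ++ phin _ _ _) with (result_word C).
    rewrite length_app. cbn [length]. lia. }
  rewrite (app_assoc (map _ _)) in H3. change (map _ _ ++ phin _ _ _) with (result_word C) in H3.
  assert (Hend : ~ In End (result_word C)).
  { unfold result_word. fold N G. rewrite in_app_iff, in_map_iff. intros [(s & Hs & Hin)|Hin].
    - assert (s = End) as -> by (destruct s; trivial; discriminate).
      apply in_app_iff in Hin. destruct Hin as [Hin|Hin].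
      + apply repeat_spec in Hin. discriminate.
      + rewrite forallb_forall in Hok. apply Hok in Hin. discriminate.
    - revert Hin. apply (clean_not_in LGates).
      unfold grown. do 3 (apply forallb_phin; [apply clean_phi|]). reflexivity. }
  destruct (run_reads B _ _ _ _ (reads_final _ Hend)) as (t4 & Ht4 & H4).
  { assert (Ho : forall w, length (out w) <= 2 * length w).
    { intro w. induction w as [|s w IH]; trivial. cbn [out flat_map].
      fold (out w). rewrite length_app. destruct s; cbn [length sym_out]; lia. }
    specialize (Ho (result_word C)). rewrite length_enc, length_app. cbn [length]. lia. }
  (* Two pushes, then reading the input and writing the output at cost at most B each, twice N+1
     passes and once G+1 passes. *)
  exists (2 + (t0 + (t1 + (t2 + (t3 + t4))))). split; [nia|].
  eapply qrun_trans; [exact Hinit|]. eapply qrun_trans; [exact H0|].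
  eapply qrun_trans; [exact H1|]. eapply qrun_trans; [exact H2|].
  eapply qrun_trans; [|exact H4].
  unfold X, grown in H3 |- *. rewrite !phin_app, <- !app_assoc in *. exact H3.
Qed.

(** * Size and time bounds *)

(** Slots dominate: a slot yields up to n gates of length linear in n. *)
Definition slot_bound (n : nat) : nat := 10 * (n + 1) * (n + 1).

Lemma length_num c z : length (num c z) = c + 1.
Proof. unfold num. rewrite length_app, repeat_length. reflexivity. Qed.

Lemma length_flat_map_bound {A B} (f : A -> list B) c l :
  (forall a, In a l -> length (f a) <= c) -> length (flat_map f l) <= c * length l.
Proof.
  induction l as [|a l IH]; intro H; simpl; [lia|]. rewrite length_app.
  pose proof (H a (or_introl eq_refl)). specialize (IH (fun a' Ha => H a' (or_intror Ha))). lia.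
Qed.

Lemma length_phin_sym k n s : length (phin k n [s]) <= slot_bound n.
Proof.
  unfold slot_bound.
  assert (Hfix : phi k s = [s] -> length (phin k n [s]) <= 10 * (n + 1) * (n + 1)).
  { intro H. rewrite phin_fixed by exact H. simpl. lia. }
  assert (Hslot : In s [AndSlot; OrSlot; CopySlot] ->
                  length (phin k n [s]) <= 10 * (n + 1) * (n + 1)).
  { intro Hs. rewrite phin_slot by exact Hs. cbn [length].
    destruct k; [|simpl; lia..].
    enough (length (flat_map (fun j => phin LHeader1 j (slot_gate s)) (seq 0 n)) <=
            (2 * n + 10) * length (seq 0 n)) by (rewrite length_seq in *; nia).
    apply length_flat_map_bound. intros j Hj. apply in_seq in Hj.
    destruct Hs as [<-|[<-|[<-|[]]]]; cbn [slot_gate];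
      rewrite phin_cons, phin_app, !phin_num by reflexivity; cbn [length];
      rewrite length_app, !length_num; cbn [grow]; lia. }
  destruct s; try (apply Hfix; reflexivity); try (apply Hslot; simpl; tauto).
  change [Stop z] with (num 0 z). rewrite phin_num, length_num.
  assert (grow k z <= 3) by (destruct k, z; simpl; lia). nia.
Qed.

Lemma length_phin_le k n w : length (phin k n w) <= slot_bound n * length w.
Proof.
  induction w as [|s w IH].
  - rewrite phin_nil. simpl. lia.
  - change (s :: w) with ([s] ++ w). rewrite phin_app, !length_app.
    pose proof (length_phin_sym k n s). cbn [length]. lia.
Qed.

Lemma slot_bound_mono n m : n <= m -> slot_bound n <= slot_bound m.
Proof. unfold slot_bound. nia. Qed.

(** Two loops lengthen the input word and three the final gates, each by a factor of at most
    [slot_bound L]; the leading L pays for the unary N. *)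
Definition word_bound (h L : nat) : nat :=
  L + slot_bound L * (slot_bound L * (h + 13 * L)) +
  slot_bound L * (slot_bound L * (slot_bound L * h)).

Lemma length_result_word C :
  length (result_word C) <=
  word_bound (length head_word + length final_word) (length (enc_circuit C)).
Proof.
  set (L := length (enc_circuit C)). set (h := length head_word + length final_word).
  assert (Hw : length (flat_map gate_word (c_gates C)) <=
               13 * length (flat_map enc_gate (c_gates C))).
  { induction (c_gates C) as [|g gs IH]; simpl; trivial. rewrite !length_app.
    enough (length (gate_word g) <= 13 * length (enc_gate g)) by lia.
    destruct g; cbn [gate_word enc_gate length app]; rewrite ?length_app, ?length_num;
      unfold enc_nat; rewrite ?length_app, ?repeat_length; cbn [length]; lia. }
  assert (HL : L = c_inputs C + 1 + length (flat_map enc_gate (c_gates C))).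
  { unfold L, enc_circuit, enc_nat. rewrite !length_app, repeat_length. reflexivity. }
  assert (HG : length (c_gates C) <= length (flat_map enc_gate (c_gates C))).
  { apply length_flat_map_le. intro g. destruct g; simpl; lia. }
  assert (Hs : forall n k w x, n <= L -> length w <= x ->
    length (phin k n w) <= slot_bound L * x).
  { intros n k w x Hn Hx. etransitivity; [apply length_phin_le|].
    apply Nat.mul_le_mono; [now apply slot_bound_mono|exact Hx]. }
  unfold result_word. rewrite length_app, length_map, length_app, repeat_length.
  unfold word_bound. apply Nat.add_le_mono; [apply Nat.add_le_mono; [lia|]|].
  - unfold grown. apply Hs; [lia|]. apply Hs; [lia|].
    unfold input_word. rewrite length_app. unfold h. lia.
  - apply Hs; [lia|]. unfold grown. apply Hs; [lia|]. apply Hs; [lia|]. unfold h. lia.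
Qed.

Definition poly_bounded (f : nat -> nat) : Prop :=
  exists a d, forall L, f L <= a * L ^ d + a.

Lemma poly_const c : poly_bounded (fun _ => c).
Proof. exists c, 0. intro L. lia. Qed.

Lemma poly_id : poly_bounded (fun L => L).
Proof. exists 1, 1. intro L. simpl. lia. Qed.

(** The added 1 covers L = 0 with d = 0. *)
Lemma pow_le_add L d e : L ^ d <= L ^ (d + e) + 1.
Proof.
  rewrite Nat.pow_add_r. destruct (Nat.eq_dec (L ^ e) 0) as [E|E]; [|nia].
  destruct L; [|apply Nat.pow_nonzero in E; [contradiction|lia]].
  destruct d; simpl; lia.
Qed.

Lemma poly_add f g : poly_bounded f -> poly_bounded g -> poly_bounded (fun L => f L + g L).
Proof.
  intros (a & d & Hf) (b & e & Hg). exists (2 * (a + b)), (d + e). intro L.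
  specialize (Hf L). specialize (Hg L).
  pose proof (pow_le_add L d e). pose proof (pow_le_add L e d).
  rewrite (Nat.add_comm e d) in *. nia.
Qed.

Lemma poly_mul f g : poly_bounded f -> poly_bounded g -> poly_bounded (fun L => f L * g L).
Proof.
  (* Up to the factor ab, the four terms of the product sum to at most 3 L^(d+e) + 3. *)
  intros (a & d & Hf) (b & e & Hg). exists (3 * (a * b)), (d + e). intro L.
  specialize (Hf L). specialize (Hg L).
  pose proof (pow_le_add L d e). pose proof (pow_le_add L e d).
  rewrite (Nat.add_comm e d) in *.
  assert (f L * g L <= (a * L ^ d + a) * (b * L ^ e + b)) by now apply Nat.mul_le_mono.
  replace ((a * L ^ d + a) * (b * L ^ e + b))
    with (a * b * (L ^ d * L ^ e + L ^ d + L ^ e + 1)) in * by ring.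
  rewrite Nat.pow_add_r in *. nia.
Qed.

Definition queue_bound (h L : nat) : nat := L + 2 + 10 * (word_bound h L + 1).
(** With B = [queue_bound h L]: at most (2L + 7) B queue steps, each costing at most 2B + 2 machine
    steps. *)
Definition time_bound (h L : nat) : nat :=
  (2 * L + 7) * queue_bound h L * (2 * queue_bound h L + 2).

Lemma time_bound_poly h : poly_bounded (time_bound h).
Proof.
  unfold time_bound, queue_bound, word_bound, slot_bound.
  repeat first [apply poly_const | apply poly_id | apply poly_add | apply poly_mul].
Qed.

(* CIRCUIT SATISFIABILITY is polynomial-time Karp reducible to
   FSR IRREDUCIBILITY (hence the latter is NP-hard). *)
Theorem theorem1 :
  poly_karp_reducible_circ circuit_satisfiable circuit_fsr_irreducible.
Proof.
  set (h := length head_word + length final_word).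
  destruct (time_bound_poly h) as (a & d & Htime).
  (* Tokens have at most five bits, hence the 4; the machine begins by pushing the end mark 11. *)
  exists (t_tm phase phase_eq_dec phases trans halted 4 PHead [true; true]), a, d. split.
  - apply q_tm_wf, t_closed; [exact phases_all|exact trans_total].
  - intros C HC. set (L := length (enc_circuit C)).
    destruct (run_machine C (queue_bound h L)) as (t & Ht & Hrun).
    { unfold queue_bound. pose proof (length_result_word C) as Hr. fold L h in Hr. lia. }
    assert (HNG : 2 * c_inputs C + length (c_gates C) <= 2 * L).
    { unfold L, enc_circuit, enc_nat. rewrite !length_app, repeat_length.
      assert (length (c_gates C) <= length (flat_map enc_gate (c_gates C)))
        by (apply length_flat_map_le; intros []; simpl; lia). lia. }
    edestruct (q_tm_correct (tstate phase)) as (cf & Hcf & Hout);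
      [apply t_closed; [exact phases_all|exact trans_total]|exact Hrun|reflexivity| |].
    2: { exists (test_circuit C), cf. split; [now apply test_circuit_wf|].
      split; [exact Hcf|]. split; [exact Hout|now apply test_circuit_correct]. }
    etransitivity; [|apply Htime]. unfold time_bound. apply Nat.mul_le_mono_r.
    etransitivity; [exact Ht|]. apply Nat.mul_le_mono_r. lia.
Qed.
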